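(* Let $\alpha\in(0,1)$ with $\alpha\ne1/n$ for all $n\in\mathbb N$, let $\mathbf X$ be an $\alpha$-branched rough path on $[0,T]$ and $a\in A$. The rough integration map $\mathfrak I^a_{\mathbf X}:\mathscr D^\alpha_{\mathbf X}\to\mathscr D^\alpha_{\mathbf X}$ is bounded: there is a constant $C=C(\alpha)$ such that for all $\mathbf Z\in\mathscr D^\alpha_{\mathbf X}$ $$|||\mathfrak I^a_{\mathbf X}(\mathbf Z)|||_\alpha\le C(1+T^\alpha)(1+|||\mathbf X|||_\alpha)\,|||\mathbf Z|||_\alpha .$$
   Context: Forests. $A$ is a fixed finite nonempty set. $\mathcal F$ is the set of forests (commutative monomials of non-planar rooted trees with nodes labelled by $A$), including the empty forest $\mathbf 1$; $\mathcal H$ is the real vector space with basis $\mathcal F$, i.e. the polynomial algebra on trees. $|h|$ is the number of nodes of $h\in\mathcal F$; $\mathcal F_{(n)}=\{h\in\mathcal F:|h|\le n\}$, $\mathcal F^+_{(n)}=\mathcal F_{(n)}\setminus\{\mathbf 1\}$. For $a\in A$, $[h]_a$ is the tree obtained by grafting the trees of $h$ on a new root labelled $a$. The coproduct $\Delta:\mathcal H\to\mathcal H\otimes\mathcal H$ is the algebra morphism with $\Delta[h]_a=(\mathrm{id}\otimes[\cdot]_a)\Delta h+[h]_a\otimes\mathbf 1$. On $\mathcal H^*$, $\langle\phi\star\psi,h\rangle=\langle\phi\otimes\psi,\Delta h\rangle$. A forest $h$ is identified with the functional $h'\mapsto\delta_{h,h'}$, so $\bar h\star h$ is a finite linear combination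 of forests. Rough paths. $N=\lfloor1/\alpha\rfloor$. An $\alpha$-branched rough path is a family $\mathbf X=(\mathbf X_{s,t})_{s,t\in[0,T]}$ of characters (unital multiplicative linear functionals) of $\mathcal H$ with $\mathbf X_{s,u}\star\mathbf X_{u,t}=\mathbf X_{s,t}$ and $\sup_{s\ne t}|\langle\mathbf X_{s,t},h\rangle|/|t-s|^{\alpha|h|}<\infty$ for all $h\in\mathcal F$. Write $\mathbf X^h_{s,t}=\langle\mathbf X_{s,t},h\rangle$, $\|F\|_\gamma=\sup_{s\neq t}|F_{s,t}|/|t-s|^\gamma$, and $|||\mathbf X|||_\alpha=\max_{h\in\mathcal F^+_{(N)}}\|\mathbf X^h\|_{|h|\alpha}$. Controlled paths. For a path $\mathbf Z:[0,T]\to\mathrm{span}\,\mathcal F_{(N-1)}$ and $h\in\mathcal F_{(N-1)}$ put $Z^h_t=\langle h,\mathbf Z_t\rangle$, $R^h_{s,t}=\langle h,\mathbf Z_t\rangle-\langle\mathbf X_{s,t}\star h,\mathbf Z_s\rangle$, and $|||\mathbf Z|||_\alpha=\sum_{h\in\mathcal F_{(N-1)}}(|\langle h,\mathbf Z_0\rangle|+\|R^h\|_{(N-|h|)\alpha})$. $\mathscr D^\alpha_{\mathbf X}$ is the Banach space of $\mathbf Z$ with $|||\mathbf Z|||_\alpha<\infty$. Rough integral. For $\mathbf Z\in\mathscr D^\alpha_{\mathbf X}$ and $a\in A$, $\int_0^tZ_s\,d\mathbf X^a_s=\lim_{|\pi|\to0}\sum_{[u,v]\in\pi}\sum_{h\in\mathcal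 F_{(N-1)}}Z^h_u\mathbf X^{[h]_a}_{u,v}$ (limit over partitions $\pi$ of $[0,t]$, which exists). $\mathfrak I^a_{\mathbf X}(\mathbf Z)$ is the path with components $\langle\mathbf 1,\mathfrak I^a_{\mathbf X}(\mathbf Z)_t\rangle=\int_0^tZ_s\,d\mathbf X^a_s$, $\langle[h]_a,\mathfrak I^a_{\mathbf X}(\mathbf Z)_t\rangle=Z^h_t$ for forests $h$ with $|h|\le N-2$, and all other components (of forests in $\mathcal F_{(N-1)}$) zero. *)

(* Defs.v *)
From HB Require Import structures.
From mathcomp Require Import all_boot all_order all_algebra finmap.
(* The notations of monalg and of mathcomp-analysis have incompatible
   levels, so the former are not imported. *)
From mathcomp Require monalg.
Import -(notations) monalg.
From mathcomp Require Import all_classical all_reals all_analysis.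

Set Implicit Arguments.
Unset Strict Implicit.
Unset Printing Implicit Defensive.

Import Order.TTheory GRing.Theory Num.Theory.
Import numFieldNormedType.Exports.

Local Open Scope classical_set_scope.
Local Open Scope ring_scope.

(* Non-planar trees are represented by planar trees in canonical form: at each
   node, the list of subtrees is sorted for the order induced by [pickle], so
   that Leibniz equality is equality up to reordering of subtrees. *)
Inductive ptree (A : Type) := PNode of A & seq (ptree A).

Lemma ptree_seq_ind (A : Type) (P : ptree A -> Prop) :
  (forall a ts, foldr (fun t Q => P t /\ Q) True ts -> P (PNode a ts)) ->
  forall t, P t.
Proof.
move=> IH; fix F 1 => -[a ts]; apply: IH.
by elim: ts => [|t ts IHts] //=; split.
Qed.

Fixpoint ptree_enc (A : Type) (t : ptree A) : GenTree.tree A :=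
  let: PNode a ts := t in
  GenTree.Node 0 (GenTree.Leaf a :: map (@ptree_enc A) ts).

Fixpoint ptree_dec (A : Type) (g : GenTree.tree A) : option (ptree A) :=
  match g with
  | GenTree.Node _ (GenTree.Leaf a :: gs) =>
      Some (PNode a (pmap (@ptree_dec A) gs))
  | _ => None
  end.

Lemma ptree_encK (A : Type) : pcancel (@ptree_enc A) (@ptree_dec A).
Proof.
apply: ptree_seq_ind => a ts H /=; congr (Some (PNode a _)).
by elim: ts H => //= t ts IH [-> /IH ->].
Qed.

HB.instance Definition _ (A : countType) :=
  Countable.copy (ptree A) (pcan_type (@ptree_encK A)).

Section Trees.
Variable A : countType.

Definition ptree_le (t u : ptree A) : bool := (choice.pickle t <= choice.pickle u)%N.

Fixpoint canon (t : ptree A) : ptree A :=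
  let: PNode a ts := t in PNode a (sort ptree_le (map canon ts)).

Lemma ptree_le_total : total ptree_le.
Proof. by move=> t u; exact: leq_total. Qed.

Lemma ptree_le_trans : transitive ptree_le.
Proof. by move=> t u v; exact: leq_trans. Qed.

Lemma ptree_le_anti : antisymmetric ptree_le.
Proof.
by move=> t u /anti_leq; apply: (pcan_inj (@choice.pickleK _)).
Qed.

Lemma canonK t : canon (canon t) = canon t.
Proof.
elim/ptree_seq_ind: t => a ts H /=; congr PNode.
have -> : map canon (sort ptree_le (map canon ts)) =
          sort ptree_le (map canon ts).
  apply: map_id_in => t; rewrite mem_sort => /mapP[u uts ->{t}].
  elim: ts H uts => //= t ts IH [Ht /IH{}IH].
  by rewrite inE => /predU1P[->|/IH].
exact/sorted_sort/sort_sorted/ptree_le_total/ptree_le_trans.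
Qed.

Record tree := Tree { planar : ptree A; _ : canon planar == planar }.

HB.instance Definition _ := [isSub for planar].
HB.instance Definition _ := [Countable of tree by <:].

Definition tree_of (t : ptree A) : tree := Tree (introT eqP (canonK t)).

Fixpoint psize (t : ptree A) : nat :=
  let: PNode _ ts := t in (sumn (map psize ts)).+1.

End Trees.

(* A forest is a commutative monomial in trees; [mone] and [mmul] are the empty
   forest and the product of forests. *)
Notation forest A := (cmonom (tree A)).

Section Forests.
Variable A : countType.

Definition tree_forest (t : tree A) : forest A := ucm t.

Definition tree_seq (h : forest A) : seq (tree A) :=
  flatten [seq nseq (h t) t | t <- enum_fset (finsupp h)].

Lemma count_tree_seq (h : forest A) t : count_mem t (tree_seq h) = h t.
Proof.
rewrite /tree_seq count_flatten -map_comp.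
rewrite (eq_map (g := fun u => h u * (u == t))%N); last first.
  by move=> u; rewrite /= count_nseq /= mulnC.
rewrite sumnE big_map; have [th|th] := boolP (t \in finsupp h).
  rewrite (big_fsetD1 t) //= eqxx muln1 big_seq big1 ?addn0// => u.
  by rewrite !inE => /andP[/negPf -> _]; rewrite muln0.
rewrite big_seq big1 => [|u uh]; first by move: th; rewrite -cmE_eq0 => /eqP.
by case: eqP => [E|]; rewrite ?muln0//; move: th; rewrite -E uh.
Qed.

(* The number of nodes. *)
Definition fsize (h : forest A) : nat :=
  (\sum_(t <- finsupp h) h t * psize (planar t))%N.

(* [h]_a, as a forest with a single tree. *)
Definition graft (a : A) (h : forest A) : forest A :=
  tree_forest (tree_of (PNode a (map (@planar A) (tree_seq h)))).

Definition forests (n : nat) : set (forest A) := [set h | (fsize h <= n)%N].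

Definition forests_pos (n : nat) : set (forest A) :=
  [set h | (fsize h <= n)%N /\ h <> mone].

Lemma graft_inj (a : A) : injective (graft a).
Proof.
move=> h1 h2 /(congr1 (fun m : forest A => m (tree_of (PNode a
  (map (@planar A) (tree_seq h1)))))); rewrite /graft !cmU eqxx.
case: eqP => // -[] + _; set s1 := sort _ _; set s2 := sort _ _ => E.
have P (h : forest A) : perm_eq (map (@planar A) (tree_seq h))
    (sort (@ptree_le A) (map (@canon A) (map (@planar A) (tree_seq h)))).
  rewrite perm_sym perm_sort -map_comp.
  suff -> : map (@canon A \o @planar A) (tree_seq h) =
            map (@planar A) (tree_seq h) by [].
  by apply: eq_map => -[t Ht]; exact: eqP Ht.
have : perm_eq (map (@planar A) (tree_seq h1)) (map (@planar A) (tree_seq h2)).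
  by apply: perm_trans (P h1) _; rewrite -/s2 -E perm_sym; exact: P.
move/(perm_map_inj (@val_inj _ _ (tree A))) => /permP Q.
by apply/eqP/cmP => t; rewrite -!count_tree_seq Q.
Qed.

Lemma graft_neq_one (a : A) h : graft a h <> mone.
Proof. by move/eqP; rewrite cm1_eq1. Qed.

End Forests.

Section FiniteForests.
Variable A : finType.

Lemma finite_planar_forests n :
  finite_set [set ts : seq (ptree A) | (sumn (map (@psize A) ts) <= n)%N].
Proof.
elim: n => [|n IH].
  by apply: (sub_finite_set _ (finite_set1 [::])) => -[|[a ts] us].
set B := [set ts | _] in IH.
pose F (x : A * (seq (ptree A) * seq (ptree A))) :=
  PNode x.1 x.2.1 :: x.2.2.
apply: (@sub_finite_set _ _ ([set [::]] `|` F @` (setT `*` (B `*` B)))).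
  move=> -[|[a ts] us] /=; first by left.
  rewrite addSn ltnS => H; right; exists (a, (ts, us)) => //.
  by do !split=> //=; apply: leq_trans H; rewrite ?leq_addr ?leq_addl.
rewrite finite_setU; split=> //; apply: finite_image.
by apply: finite_setX => //; exact: finite_setX.
Qed.

Lemma finite_forests n : finite_set (@forests A n).
Proof.
pose f (h : forest A) := map (@planar A) (tree_seq h).
have fE h : sumn (map (@psize A) (f h)) = fsize h.
  rewrite /f /tree_seq -map_comp sumnE big_map big_flatten big_map.
  by apply: eq_bigr => t _; rewrite big_nseq iter_addn_0 mulnC.
have -> : forests n =
    f @^-1` [set ts | (sumn (map (@psize A) ts) <= n)%N].
  by apply/seteqP; split=> h; rewrite /forests /= fE.
apply: finite_preimage (finite_planar_forests n) => h1 h2 _ _ /inj_map E.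
apply/eqP/cmP => t; rewrite -!count_tree_seq E //; exact: val_inj.
Qed.
End FiniteForests.

Section ProdConom.
Variables M N : conomType.

Definition pair_one : M * N := (mone, mone).
Definition pair_mul (x y : M * N) : M * N := (mmul x.1 y.1, mmul x.2 y.2).

Lemma pair_mulA : associative pair_mul.
Proof. by move=> x y z; rewrite /pair_mul /= !monalg.mulmA. Qed.

Lemma pair_mul1 : left_id pair_one pair_mul.
Proof. by case=> x y; rewrite /pair_mul /= !mul1m. Qed.

Lemma pair_mulr1 : right_id pair_one pair_mul.
Proof. by case=> x y; rewrite /pair_mul /= !mulm1. Qed.

Lemma pair_unitm x y :
  pair_mul x y = pair_one -> x = pair_one /\ y = pair_one.
Proof.
by case: x y => [x x'] [y y'] [/unitm[-> ->] /unitm[-> ->]].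
Qed.

Lemma pair_mulC : commutative pair_mul.
Proof.
by move=> x y; rewrite /pair_mul; congr (_, _); exact: mulmC.
Qed.

HB.instance Definition _ := Choice_isMonomialDef.Build (M * N)%type
  pair_mulA pair_mul1 pair_mulr1 pair_unitm.
HB.instance Definition _ :=
  MonomialDef_isConomialDef.Build (M * N)%type pair_mulC.

End ProdConom.

Notation hopf R A := (malg (forest A) R).

(* The tensor square of [hopf R A], as the vector space (and algebra, with the
   componentwise product) with basis h1 (x) h2, for h1 and h2 forests. *)
Notation hopf2 R A := (malg (forest A * forest A)%type R).

Section Hopf.
Variables (R : realType) (A : countType).

Definition basis (h : forest A) : hopf R A := mkmalgU h 1.
Definition tensor (h1 h2 : forest A) : hopf2 R A := mkmalgU (h1, h2) 1.

(* The linear map id (x) [.]_a. *)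
Definition id_graft (a : A) (w : hopf2 R A) : hopf2 R A :=
  \sum_(p <- msupp w) mcoeff p w *: tensor p.1 (graft a p.2).

(* The coproduct is defined by recursion on planar trees, and does not depend
   on the order of subtrees; its characteristic properties are the lemmas
   [coproduct_is_linear], [coproduct1], [coproductM] and [coproduct_graft]. *)
Fixpoint coproduct_ptree (t : ptree A) : hopf2 R A :=
  let: PNode a ts := t in
  id_graft a (foldr (fun u w => coproduct_ptree u * w) 1 ts)
  + tensor (tree_forest (tree_of t)) mone.

Definition coproduct_forest (h : forest A) : hopf2 R A :=
  \prod_(t <- finsupp h) coproduct_ptree (planar t) ^+ h t.

Definition coproduct (x : hopf R A) : hopf2 R A :=
  \sum_(h <- msupp x) mcoeff h x *: coproduct_forest h.

Lemma coproduct_forestEw (d : {fset tree A}) (h : forest A) :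
  (finsupp h `<=` d)%fset ->
  coproduct_forest h = \prod_(t <- d) coproduct_ptree (planar t) ^+ h t.
Proof.
move=> hd; apply: big_fset_incl => // t _; rewrite -cmE_eq0 => /eqP ->.
by rewrite expr0.
Qed.

Lemma coproduct_forest1 : coproduct_forest (@mone (forest A)) = 1.
Proof. by rewrite /coproduct_forest mdom1 big_nil. Qed.

Lemma coproduct_forestM h1 h2 :
  coproduct_forest (mmul h1 h2) = coproduct_forest h1 * coproduct_forest h2.
Proof.
rewrite {1}/coproduct_forest mdomD.
rewrite (coproduct_forestEw (fsubsetUl _ (finsupp h2))).
rewrite (coproduct_forestEw (fsubsetUr (finsupp h1) _)) -big_split /=.
by apply: eq_bigr => t _; rewrite cmM exprD.
Qed.

Lemma coproduct_forest_tree t :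
  coproduct_forest (tree_forest t) = coproduct_ptree (planar t).
Proof.
by rewrite /coproduct_forest mdomU big_seq_fset1 cmUU expr1.
Qed.

HB.instance Definition _ := isMultiplicative.Build (forest A) (hopf2 R A)
  (coproduct_forest) (coproduct_forestM, coproduct_forest1).

Lemma coproductE (x : hopf R A) :
  coproduct x = mmap (mkmalgU mone) (coproduct_forest) x.
Proof. by apply: eq_bigr => h _; rewrite mul_malgC. Qed.

Lemma coproduct_basis h : coproduct (basis h) = coproduct_forest h.
Proof. by rewrite coproductE mmapU mul_malgC scale1r. Qed.

Lemma coproduct_is_linear : linear (coproduct).
Proof.
move=> c x y; rewrite !coproductE mmapD; congr (_ + _).
by rewrite mmapZ mul_malgC.
Qed.

Lemma coproduct1 : coproduct (1 : hopf R A) = 1.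
Proof. by rewrite coproductE mmap1. Qed.

Lemma coproductM (x y : hopf R A) :
  coproduct (x * y) = coproduct x * coproduct y.
Proof.
rewrite !coproductE.
exact: (rmorphM (mmap (mkmalgU mone) (coproduct_forest))).
Qed.

Lemma big_tree_seq (M : comNzRingType) (F : tree A -> M) h :
  \prod_(t <- tree_seq h) F t = \prod_(t <- finsupp h) F t ^+ h t.
Proof.
rewrite /tree_seq big_flatten /= big_map; apply: eq_bigr => t _.
by rewrite big_nseq -Monoid.iteropE.
Qed.

Lemma coproduct_ptreeE (a : A) (ts : seq (ptree A)) :
  coproduct_ptree (PNode a ts) =
  id_graft a (\prod_(u <- ts) coproduct_ptree u)
  + tensor (tree_forest (tree_of (PNode a ts))) mone.
Proof.
have -> : \prod_(u <- ts) coproduct_ptree u =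
    foldr (fun u w => coproduct_ptree u * w) 1 ts.
  by elim: ts => [|t ts IH]; rewrite ?big_nil ?big_cons ?IH.
by [].
Qed.

Lemma coproduct_graft (a : A) h :
  coproduct (basis (graft a h)) =
  id_graft a (coproduct (basis h)) + tensor (graft a h) mone.
Proof.
have Eh : coproduct (basis h) =
    \prod_(t <- tree_seq h) coproduct_ptree (planar t).
  by rewrite (big_tree_seq _ h); exact: coproduct_basis.
rewrite [X in id_graft _ X]Eh => {Eh}.
apply: etrans (coproduct_basis _) _; rewrite /graft; set t := PNode a _.
apply: etrans (coproduct_forest_tree _) _.
have <- : tree_of (canon t) = tree_of t by apply: val_inj; exact: canonK.
have -> : planar (tree_of (canon t)) = canon t by exact: canonK.
apply: etrans (coproduct_ptreeE _ _) _.
apply: (congr1 (fun x => id_graft a x + _)).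
rewrite (perm_big _ (permEl (perm_sort _ _))) /= -map_comp big_map.
apply: eq_bigr => u _ /=.
case: u => u Hu; rewrite [planar _]/=; congr coproduct_ptree; exact: eqP Hu.
Qed.

(* Functionals on [hopf R A]; the functional identified with a forest h is
   [mcoeff h]. *)
Definition star (phi psi : hopf R A -> R) (x : hopf R A) : R :=
  \sum_(p <- msupp (coproduct x))
    mcoeff p (coproduct x) * (phi (basis p.1) * psi (basis p.2)).

Definition character (phi : hopf R A -> R) : Prop :=
  [/\ scalar phi, phi 1 = 1 & {morph phi : x y / x * y}].

End Hopf.

Section Holder.
Variable R : realType.

Definition holder (T gamma : R) (F : R -> R -> R) : \bar R :=
  ereal_sup [set (`|F p.1 p.2| / `|p.2 - p.1| `^ gamma)%:E |
    p in [set p : R * R | [/\ p.1 \in `[0, T], p.2 \in `[0, T] & p.1 != p.2]]].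

(* A partition 0 < s_1 < ... < s_k = t is represented by [:: s_1; ...; s_k]. *)
Definition intervals (s : seq R) : seq (R * R) := zip (0 :: s) s.

Definition mesh (s : seq R) : R :=
  \big[Num.max/0]_(p <- intervals s) (p.2 - p.1).

(* The neighbourhoods of |pi| -> 0, for pi a partition of [0, t]. *)
Definition mesh_filter (t : R) : set_system (seq R) :=
  filter_from [set d : R | 0 < d]
    (fun d => [set s | itv_partition 0 t s /\ mesh s < d]).

End Holder.

Section RoughPaths.
Variables (R : realType) (A : finType) (alpha T : R).

(* N, the integer part of 1 / alpha. *)
Definition level : nat := Num.truncn alpha^-1.

Definition branched_rough_path (X : R -> R -> hopf R A -> R) : Prop :=
  [/\ forall s t, s \in `[0, T] -> t \in `[0, T] -> character (X s t),
      forall s u t, s \in `[0, T] -> u \in `[0, T] -> t \in `[0, T] ->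
        forall x, star (X s u) (X u t) x = X s t x
    & forall h : forest A,
        (holder T (alpha *+ fsize h) (fun s t => X s t (basis R h)) < +oo)%E].

(* The maximum over a finite set of forests, by [finite_forests]. *)
Definition rough_norm (X : R -> R -> hopf R A -> R) : \bar R :=
  ereal_sup [set holder T (alpha *+ fsize h) (fun s t => X s t (basis R h)) |
    h in @forests_pos A level].

Section Controlled.
Variables (X : R -> R -> hopf R A -> R) (Z : R -> hopf R A).

Definition remainder (h : forest A) (s t : R) : R :=
  mcoeff h (Z t) - star (X s t) (mcoeff h) (Z s).

Definition controlled_norm : \bar R :=
  (\sum_(h \in @forests A level.-1)
    (`|mcoeff h (Z 0)|%:E
     + holder T (alpha *+ (level - fsize h)) (remainder h)))%E.

Definition controlled : Prop :=
  (forall t, t \in `[0, T] -> [set` msupp (Z t)] `<=` forests level.-1)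
  /\ (controlled_norm < +oo)%E.

Definition riemann_sum (a : A) (s : seq R) : R :=
  \sum_(p <- intervals s)
    \sum_(h \in @forests A level.-1)
      mcoeff h (Z p.1) * X p.1 p.2 (basis R (graft a h)).

Definition rough_integral (a : A) (t : R) : R :=
  lim (riemann_sum a @ mesh_filter t).

Definition rough_integration (a : A) (t : R) : hopf R A :=
  rough_integral a t *: basis R mone
  + \sum_(h <- msupp (Z t) | (fsize h + 2 <= level)%N)
      mcoeff h (Z t) *: basis R (graft a h).

(* The components of [rough_integration a t] are given by the next lemmas. *)
Lemma mcoeff_rough_integration_one (a : A) (t : R) :
  mcoeff mone (rough_integration a t) = rough_integral a t.
Proof.
rewrite /rough_integration mcoeffD mcoeffZ mcoeffU eqxx mulr1.
rewrite raddf_sum big1 ?addr0 // => h _ /=; rewrite mcoeffZ mcoeffU.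
by case: eqP => [/graft_neq_one|]; rewrite ?mulr0.
Qed.

Lemma mcoeff_rough_integration_graft (a : A) (t : R) h :
  mcoeff (graft a h) (rough_integration a t) =
  if (fsize h + 2 <= level)%N then mcoeff h (Z t) else 0.
Proof.
rewrite /rough_integration mcoeffD mcoeffZ mcoeffU eq_sym.
case: eqP => [/graft_neq_one//|_]; rewrite mulr0 add0r raddf_sum /=.
transitivity (\sum_(k <- msupp (Z t) | (fsize k + 2 <= level)%N)
   if k == h then mcoeff h (Z t) else 0).
  apply: eq_bigr => k _; rewrite mcoeffZ mcoeffU (inj_eq (@graft_inj _ a)).
  by case: eqP => [->|]; rewrite ?mulr1 ?mulr0.
have [hZ|hZ] := boolP (h \in msupp (Z t)).
  rewrite big_mkcond (big_fsetD1 h) //= eqxx [X in _ + X]big_seq big1 ?addr0//.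
  by move=> k; rewrite !inE => /andP[/negPf -> _]; rewrite if_same.
by rewrite mcoeff_outdom // if_same big1 // => k _; rewrite if_same.
Qed.

Lemma mcoeff_rough_integration_other (a : A) (t : R) g :
  g <> mone -> (forall h, g <> graft a h) ->
  mcoeff g (rough_integration a t) = 0.
Proof.
move=> g1 ga; rewrite /rough_integration mcoeffD mcoeffZ mcoeffU eq_sym.
case: eqP => // _; rewrite mulr0 add0r raddf_sum big1 // => h _ /=.
by rewrite mcoeffZ mcoeffU eq_sym; case: eqP => [/ga|]; rewrite ?mulr0.
Qed.

End Controlled.
End RoughPaths.

(* Main.v *)
Require Import Defs.
From HB Require Import structures.
From mathcomp Require Import all_boot all_order all_algebra finmap.
From mathcomp Require Import zify ring lra.
From mathcomp Require monalg.
Import -(notations) monalg.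
From mathcomp Require Import all_classical all_reals all_analysis.

Set Implicit Arguments.
Unset Strict Implicit.
Unset Printing Implicit Defensive.

Import Order.TTheory GRing.Theory Num.Theory.
Import numFieldNormedType.Exports.

Local Open Scope classical_set_scope.
Local Open Scope ring_scope.

(* Write [A s t = \sum_h Z^h_s X^([h]_a)_(s,t)], summed over [|h| <= N - 1]. Chen's
   relation and the recursion for the coproduct of a grafted tree give
   [A s t - A s u - A u t = - \sum_h R^h_(s,u) X^([h]_a)_(u,t)], which is
   O(|t - s|^((N + 1) alpha)) with [(N + 1) alpha > 1], so that the rough integral
   is obtained by sewing and satisfies
   [\int_s^t Z dX^a = A s t + O(|t - s|^((N + 1) alpha))].
   The remainder of the integral at the empty forest is this error plus the terms
   [|h| = N - 1] of [A]; its remainder at [[k]_a] is [R^k] plus the terms of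
   <X_(s,t) * k, Z_s> carried by the forests [l] with [|l| = N - 1]; the other
   remainders vanish. For [|l| = N - 1] the component [Z^l] is bounded by
   [|Z^l_0| + T^alpha ||R^l||]. A forest [h] has at most [2^|h|] cuts, so the
   constant does not depend on the set of labels. *)

(** * Sewing *)

Section Sewing.
Variable R : realType.

(** The base point is free so that a chain can be cut in two; for [s = 0] the pairs are those of
    [intervals l]. *)
Definition chain_sum (A : R -> R -> R) (s : R) (l : seq R) : R :=
  \sum_(p <- zip (s :: l) l) A p.1 p.2.

Lemma chain_sum_nil A s : chain_sum A s [::] = 0.
Proof. by rewrite /chain_sum big_nil. Qed.

Lemma chain_sum_cons A s u l :
  chain_sum A s (u :: l) = A s u + chain_sum A u l.
Proof. by rewrite /chain_sum /= big_cons. Qed.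

Lemma chain_sum_cat A s l1 l2 :
  chain_sum A s (l1 ++ l2) = chain_sum A s l1 + chain_sum A (last s l1) l2.
Proof.
elim: l1 s => [|u l1 IH] s; first by rewrite chain_sum_nil add0r.
by rewrite /= !chain_sum_cons IH addrA.
Qed.

Lemma path_ge_last (s : R) l : path <=%R s l -> s <= last s l.
Proof.
elim: l s => //= u l IH s /andP[su /IH]; exact: le_trans.
Qed.

Lemma path_le_last (s : R) l x : path <=%R s l -> x \in s :: l -> x <= last s l.
Proof.
elim: l s x => [|u l IH] s x /=; first by rewrite inE => _ /eqP ->.
move=> /andP[su pl]; rewrite inE => /predU1P[->|/(IH _ _ pl)//].
exact: le_trans su (path_ge_last pl).
Qed.

Lemma path_split (s m : R) l : s <= m -> m <= last s l -> l != [::] ->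
  exists l1 u l2, [/\ l = l1 ++ u :: l2, last s l1 <= m & m <= u].
Proof.
elim: l s => // u l IH s sm /= ml _.
have [mu|um] := leP m u; first by exists [::], u, l.
case: l IH ml => [|v l] IH ml; first by move: (lt_le_trans um ml); rewrite ltxx.
have [l1 [w [l2 [-> ? ?]]]] := IH u (ltW um) ml isT.
by exists (u :: l1), w, l2.
Qed.

Lemma subseq_consP (T : eqType) (u : T) l l' : subseq (u :: l) l' ->
  exists p1 p2, l' = p1 ++ u :: p2 /\ subseq l p2.
Proof.
elim: l' => //= v l' IH; case: eqVneq => [->|_] sub; first by exists [::], l'.
by have [p1 [p2 [-> ?]]] := IH sub; exists (v :: p1), p2.
Qed.

(** The solution of [c = c 2^(1 - theta) + 2], the relation under which the bisection in
    [chain_sum_bound] reproduces its own constant. *)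
Definition sewing_const (theta : R) : R := 2 / (1 - 2 `^ (1 - theta)).

Lemma sewing_const_gt0 theta : 1 < theta -> 0 < sewing_const theta.
Proof.
move=> t1; apply: divr_gt0 => //; rewrite subr_gt0 lt_neqAle powR_eq1.
rewrite -[leRHS](powRr0 2) ler_powR ?ler1n//; last lra.
by rewrite andbT !negb_or; apply/and3P; split; [lra|lra|lra].
Qed.

Lemma sewing_constE theta : 1 < theta ->
  sewing_const theta * 2 `^ (1 - theta) + 2 = sewing_const theta.
Proof.
move=> t1; have := sewing_const_gt0 t1; rewrite /sewing_const => c0.
have : 1 - 2 `^ (1 - theta) != 0.
  by apply: contraTneq c0 => ->; rewrite invr0 mulr0 ltxx.
move=> n0; by field.
Qed.


Lemma mesh_partition (d : R) : 0 < d -> forall s t, s <= t ->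
  exists l, [/\ path <%R s l, last s l = t &
    all (fun p => p.2 - p.1 < d) (zip (s :: l) l)].
Proof.
move=> d0 s t st.
(* Induction on the number of steps of length [d / 2], which is strictly less than [d] as the mesh
   condition requires. *)
have [n] : exists n, t - s < n%:R * (d / 2).
  exists (Num.truncn ((t - s) / (d / 2))).+1.
  by rewrite -ltr_pdivrMr ?divr_gt0// truncnS_gt.
elim: n s st => [|n IH] s st; first by rewrite mul0r => ?; exfalso; lra.
rewrite -natr1 => tn.
have [tsd|dts] := ltP (t - s) d.
  have [<-|st'] := eqVneq s t; first by exists [::].
  by exists [:: t]; rewrite /= !andbT lt_neqAle st' st tsd.
have [||l [pl lt al]] := IH (s + d / 2); [lra|lra|].
exists (s + d / 2 :: l) => /=; rewrite pl al lt; split=> //; rewrite andbT; lra.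
Qed.

(** The default value 0 of the maximum in [mesh] is harmless since [0 < d]. *)
Lemma mesh_ltP (d : R) l : 0 < d ->
  (mesh l < d) = all (fun p => p.2 - p.1 < d) (zip (0 :: l) l).
Proof.
move=> d0; apply/idP/allP => [ml p pl|H].
  by apply: le_lt_trans ml;
  exact: (@Order.TotalTheory.le_bigmax_seq _ _ _ _ 0 p xpredT
    (fun p => p.2 - p.1)).
by rewrite /mesh big_seq; apply: bigmax_lt.
Qed.

Lemma path_ltW (s : R) l : path <%R s l -> path <=%R s l.
Proof. exact: sub_path ltW _ _. Qed.

(** Each term is [v - u] times [(v - u)^(theta - 1)]; the second factor is at most [d^(theta - 1)]
    and the lengths telescope. *)
Lemma chain_sum_powR (theta d : R) s l : 1 < theta -> 0 < d ->
  path <=%R s l -> all (fun p => p.2 - p.1 < d) (zip (s :: l) l) ->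
  chain_sum (fun u v => (v - u) `^ theta) s l
    <= (last s l - s) * d `^ (theta - 1).
Proof.
move=> t1 d0; elim: l s => [|u l IH] s; first by rewrite chain_sum_nil subrr mul0r.
rewrite chain_sum_cons /= => /andP[su pl] /andP[ud al].
rewrite -(subrKC u (last u l)) addrAC mulrDl lerD ?IH//.
have us : 0 <= u - s by rewrite subr_ge0.
rewrite -mulr_powRB1//; last lra.
rewrite ler_wpM2l// ge0_ler_powR ?nnegrE ?(ltW ud) ?(ltW d0)//; lra.
Qed.

Lemma small_powR (M e p : R) : 0 <= M -> 0 < e -> 0 < p ->
  exists2 d, 0 < d & M * d `^ p < e.
Proof.
(* Dividing by [M + 1] instead of [M] covers [M = 0] and keeps the inequality strict. *)
move=> M0 e0 p0; exists ((e / (M + 1)) `^ p^-1).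
  by rewrite powR_gt0// divr_gt0//; lra.
rewrite -powRrM mulVf ?gt_eqF// powRr1; last by rewrite divr_ge0 ?ltW//; lra.
have M1 : 0 < M + 1 by lra.
by rewrite mulrCA gtr_pMr// ltr_pdivrMr//; lra.
Qed.

Lemma mesh_filter_proper (t : R) : 0 <= t -> ProperFilter (mesh_filter t).
Proof.
move=> t0; apply: filter_from_proper => [|d d0].
  apply: filter_from_filter => [|d d' d0 d'0]; first by exists 1 => /=.
  exists (Num.min d d'); first by rewrite /= lt_min d0.
  by move=> l /= [pl]; rewrite lt_min => /andP[].
have [l [pl lt al]] := mesh_partition d0 t0.
by exists l; split; [split=> //; exact/eqP|rewrite mesh_ltP].
Qed.

(** Partitions are strictly increasing, so the only partition of [[0, 0]] is the empty list. *)
Lemma lim_chain_sum0 (A : R -> R -> R) :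
  lim (chain_sum A 0 @ mesh_filter (0 : R)) = 0.
Proof.
have F0 := mesh_filter_proper (lexx 0).
apply/cvg_lim; first exact: norm_hausdorff.
apply/cvgrPdist_lt => e e0; exists 1 => //= l [[pl /eqP l0] _].
suff -> : l = [::] by rewrite chain_sum_nil subr0 normr0.
case: l pl l0 => //= x l /andP[x0 /path_ltW/path_ge_last xl] E.
by move: (lt_le_trans x0 xl); rewrite E ltxx.
Qed.


(** * The sewing lemma for an almost additive function of two times *)

Section AlmostAdditive.
Variables (A : R -> R -> R) (T K theta : R).
Hypothesis theta_gt1 : 1 < theta.
Hypothesis K_ge0 : 0 <= K.
Hypothesis A_diag : forall s : R, 0 <= s <= T -> A s s = 0.
Hypothesis A_delta : forall s u t : R, 0 <= s -> s <= u -> u <= t -> t <= T ->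
  `|A s t - A s u - A u t| <= K * (t - s) `^ theta.

Let c := sewing_const theta.

(** The left side is [2^(1 - theta) (2 y)^theta]. The factor [2^(1 - theta)] is less than 1, which
    makes the bisection contract. *)
Lemma powR_half (x y : R) : 0 <= y -> 2 * y <= x ->
  2 * y `^ theta <= 2 `^ (1 - theta) * x `^ theta.
Proof.
have t1 := theta_gt1; move=> y0 yx; have xx : x `^ theta >= (2 * y) `^ theta.
  by apply: ge0_ler_powR; rewrite ?nnegrE /=; lra.
apply: (@le_trans _ _ (2 `^ (1 - theta) * (2 * y) `^ theta)).
  rewrite powRM// mulrA -powRD ?pnatr_eq0 ?implybT//.
  by rewrite subrK powRr1.
by rewrite ler_pM2l// powR_gt0.
Qed.

(* Cut the chain at its interval that contains the midpoint of [s, last s l]: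
   the two remaining chains are at most half as long. *)
Lemma chain_sum_bound s l : 0 <= s -> path <=%R s l -> last s l <= T ->
  `|chain_sum A s l - A s (last s l)| <= c * K * (last s l - s) `^ theta.
Proof.
have [t1 K0] := (theta_gt1, K_ge0); have c0 : 0 < c by exact: sewing_const_gt0.
have cE : c * 2 `^ (1 - theta) + 2 = c by exact: sewing_constE.
have [n] := ubnP (size l); elim: n s l => // n IH s l; rewrite ltnS => ln.
move=> s0 pl lT; have sl := path_ge_last pl.
have [->|l0] := eqVneq l [::].
  rewrite chain_sum_nil /= A_diag; last by rewrite s0 (le_trans sl).
  by rewrite subrr normr0 mulr_ge0 ?powR_ge0// mulr_ge0// ltW.
pose t := last s l; rewrite -/t in lT sl *; pose m := (s + t) / 2.
have sm : s <= m by rewrite /m; lra.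
have mt : m <= t by rewrite /m; lra.
have [l1 [u [l2 [El l1m mu]]]] := path_split sm mt l0.
move: pl ln; rewrite El cat_path /= size_cat /= => /and3P[p1 vu p2] ln.
pose v := last s l1; rewrite -/v in vu l1m.
have ut : t = last u l2 by rewrite /t El last_cat.
have sv : s <= v := path_ge_last p1.
have {}p2t : u <= t by rewrite ut path_ge_last.
have B1 : `|chain_sum A s l1 - A s v| <= c * K * (v - s) `^ theta.
  apply: IH => //; last by rewrite -/v; lra.
  by apply: leq_trans ln; rewrite addnS ltnS leq_addr.
have B2 : `|chain_sum A u l2 - A u t| <= c * K * (t - u) `^ theta.
  rewrite ut; apply: IH; rewrite -?ut//; last lra.
  by apply: leq_trans ln; rewrite addnS ltnS leq_addl.
have D1 : `|A s t - A s v - A v t| <= K * (t - s) `^ theta.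
  by apply: A_delta; lra.
have D2 : `|A v t - A v u - A u t| <= K * (t - s) `^ theta.
  apply: (@le_trans _ _ (K * (t - v) `^ theta)); first by apply: A_delta; lra.
  by rewrite ler_wpM2l// ge0_ler_powR ?nnegrE /=; lra.
have H1 : 2 * (v - s) `^ theta <= 2 `^ (1 - theta) * (t - s) `^ theta.
  by apply: powR_half; rewrite /m in l1m; lra.
have H2 : 2 * (t - u) `^ theta <= 2 `^ (1 - theta) * (t - s) `^ theta.
  by apply: powR_half; rewrite /m in mu; lra.
rewrite chain_sum_cat chain_sum_cons -/v.
(* The errors of the two shorter chains contribute [c 2^(1 - theta)], and the defects of additivity
   at [v] and at [u] contribute the 2 in [sewing_constE]. *)
have -> : chain_sum A s l1 + (A v u + chain_sum A u l2) - A s t =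
  (chain_sum A s l1 - A s v) + (chain_sum A u l2 - A u t)
  - (A s t - A s v - A v t) - (A v t - A v u - A u t) by ring.
apply: (le_trans (ler_normB _ _)); apply: (le_trans (lerD (ler_normB _ _) D2)).
apply: (le_trans (lerD (lerD (ler_normD _ _) D1) (lexx _))).
apply: (le_trans (lerD (lerD (lerD B1 B2) (lexx _)) (lexx _))).
have cK : 0 <= c * K by rewrite mulr_ge0// ltW.
rewrite -[in leRHS]cE; nra.
Qed.

(** Over each interval of the coarse chain the fine one is itself a chain, which [chain_sum_bound]
    compares with a single increment. *)
Lemma chain_sum_refine s l l' : 0 <= s -> path <=%R s l -> path <=%R s l' ->
  last s l = last s l' -> last s l' <= T -> subseq l l' ->
  `|chain_sum A s l' - chain_sum A s l|
    <= c * K * chain_sum (fun u v => (v - u) `^ theta) s l.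
Proof.
have t0 : theta != 0 by rewrite gt_eqF// (lt_trans _ theta_gt1).
elim: l s l' => [|u l IH] s l' s0.
  (* The rest of [l'] now starts and ends at [s]: its bound is a multiple of [0^theta], which
     vanishes because [theta] is nonzero. *)
  rewrite /= => _ p' E lT _; have := chain_sum_bound s0 p' lT.
  rewrite -E subrr powR0// !chain_sum_nil A_diag//.
  by rewrite s0; move: lT; rewrite -E.
move=> /= /andP[su pl] p' E lT /subseq_consP[p1 [p2 [El' sub]]].
move: p' E lT; rewrite {}El' cat_path last_cat /= => /and3P[p'1 p1u p'2] E lT.
have u0 : 0 <= u by exact: le_trans su.
have B1 : `|chain_sum A s (rcons p1 u) - A s u| <= c * K * (u - s) `^ theta.
  have := @chain_sum_bound s (rcons p1 u) s0.
  rewrite last_rcons rcons_path p'1; apply=> //.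
  by apply: le_trans lT; exact: path_ge_last.
have B2 := IH _ _ u0 pl p'2 E lT sub.
rewrite -cat_rcons chain_sum_cat last_rcons !chain_sum_cons.
rewrite opprD addrACA mulrDr; apply: le_trans (ler_normD _ _) (lerD B1 B2).
Qed.

(** Both partitions are compared with a common refinement, whence the factor 2. *)
Lemma chain_sum_close t d l l' : 0 <= t <= T -> 0 < d ->
  itv_partition 0 t l -> mesh l < d -> itv_partition 0 t l' -> mesh l' < d ->
  `|chain_sum A 0 l - chain_sum A 0 l'| <= 2 * c * K * t * d `^ (theta - 1).
Proof.
have c0 : 0 < c by exact: sewing_const_gt0.
move=> /andP[t0 tT] d0 [/path_ltW pl /eqP lt] ml [/path_ltW pl' /eqP lt'] ml'.
(* Points common to both partitions are repeated in [m], so it increases only in the wide sense;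
   this is why chains are paths for [<=]. *)
pose m := sort <=%R (l ++ l').
have tot : total (<=%R : rel R) by exact: le_total.
have tr : transitive (<=%R : rel R) by exact: le_trans.
have mem_m x : x \in m = (x \in l ++ l') by rewrite mem_sort.
have sub1 : subseq l m.
  by rewrite -(sorted_sort tr (path_sorted pl)) subseq_sort ?prefix_subseq.
have sub2 : subseq l' m.
  by rewrite -(sorted_sort tr (path_sorted pl')) subseq_sort ?suffix_subseq.
have pm : path <=%R 0 m.
  rewrite path_sortedE// sort_sorted// andbT; apply/allP => x.
  rewrite mem_m mem_cat => /orP[xl|xl'].
    by move: pl; rewrite path_sortedE// => /andP[/allP/(_ x xl)].
  by move: pl'; rewrite path_sortedE// => /andP[/allP/(_ x xl')].
have mt : last 0 m = t.
  apply/eqP; rewrite eq_le; apply/andP; split; last first.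
    apply: path_le_last pm _; rewrite -lt.
    have := mem_last 0 l; rewrite !inE => /orP[->//|/(mem_subseq sub1) ->].
    by rewrite orbT.
  have := mem_last 0 m; rewrite inE mem_m mem_cat => /or3P[/eqP ->//|H|H].
    by rewrite -lt; apply: path_le_last pl _; rewrite inE H orbT.
  by rewrite -lt'; apply: path_le_last pl' _; rewrite inE H orbT.
have step k : path <=%R 0 k -> last 0 k = t -> mesh k < d -> subseq k m ->
    `|chain_sum A 0 m - chain_sum A 0 k| <= c * K * (t * d `^ (theta - 1)).
  move=> pk kt mk sub.
  apply: le_trans (chain_sum_refine (lexx 0) pk pm _ _ sub) _.
  - by rewrite kt mt.
  - by rewrite mt.
  have cK : 0 <= c * K by rewrite mulr_ge0// ltW.
  rewrite (ler_wpM2l cK)// -[t]subr0 -kt.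
  by apply: chain_sum_powR => //; rewrite -mesh_ltP.
have := step _ pl lt ml sub1; have := step _ pl' lt' ml' sub2.
set b := c * K * _ => b1 b2.
apply: le_trans (_ : b + b <= _); last first.
  by rewrite /b -!mulrA mulr_natl mulr2n.
by rewrite (le_trans (ler_distD (chain_sum A 0 m) _ _))// lerD// distrC.
Qed.

(** By completeness: the sum along one partition of mesh below [d] is within [e] of all the
    others. *)
Lemma chain_sum_cvg (t : R) : 0 <= t <= T -> cvg (chain_sum A 0 @ mesh_filter t).
Proof.
move=> tT; have t0 : 0 <= t by case/andP: tT.
have FF := mesh_filter_proper t0; apply: cauchy_cvg; apply: cauchy_exP => e e0.
have c0 : 0 <= c by apply: ltW; exact: sewing_const_gt0.
have M0 : 0 <= 2 * c * K * t by rewrite mulr_ge0// mulr_ge0// mulr_ge0.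
have p0 : 0 < theta - 1 by rewrite subr_gt0.
have [d d0 de] := small_powR M0 e0 p0.
have [l [pl lt al]] := mesh_partition d0 t0; exists (chain_sum A 0 l).
exists d => // l' [pl' ml']; apply: le_lt_trans de; apply: chain_sum_close => //.
- by split=> //; exact/eqP.
- by rewrite mesh_ltP.
Qed.

(** A fine partition of [[0, s]] followed by one of [[s, t]] is a fine partition of [[0, t]]. The
    two Riemann sums differ by a chain from [s] to [t], to which [chain_sum_bound] applies. *)
Lemma sewing (s t : R) : 0 <= s -> s <= t -> t <= T ->
  `|lim (chain_sum A 0 @ mesh_filter t) - lim (chain_sum A 0 @ mesh_filter s)
    - A s t| <= c * K * (t - s) `^ theta.
Proof.
move=> s0 st tT; set It := lim _; set Is := lim _.
have Ct : chain_sum A 0 @ mesh_filter t --> It.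
  by apply: chain_sum_cvg; rewrite tT (le_trans s0).
have Cs : chain_sum A 0 @ mesh_filter s --> Is.
  by apply: chain_sum_cvg; rewrite s0 (le_trans st).
have Ft := mesh_filter_proper (le_trans s0 st).
have Fs := mesh_filter_proper s0.
apply/ler_addgt0Pr => e e0.
have e20 : 0 < e / 2 by rewrite divr_gt0.
have [dt /= dt0 Ht] : mesh_filter t [set l | `|It - chain_sum A 0 l| < e / 2].
  by have /cvgrPdist_lt/(_ _ e20) := Ct.
have [ds /= ds0 Hs] : mesh_filter s [set l | `|Is - chain_sum A 0 l| < e / 2].
  by have /cvgrPdist_lt/(_ _ e20) := Cs.
have d0 : 0 < Num.min dt ds by rewrite lt_min dt0.
have [l1 [p1 E1 a1]] := mesh_partition d0 s0.
have [l2 [p2 E2 a2]] := mesh_partition d0 st.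
have zipE : zip (0 :: l1 ++ l2) (l1 ++ l2) = zip (0 :: l1) l1 ++ zip (s :: l2) l2.
  rewrite -E1; elim: (l1) 0 => //= x l IH y; by rewrite IH.
have /Hs /= B1 : itv_partition 0 s l1 /\ mesh l1 < ds.
  split; first by split=> //; exact/eqP.
  rewrite mesh_ltP//; apply: sub_all a1 => p; rewrite lt_min => /andP[] //.
have /Ht /= : itv_partition 0 t (l1 ++ l2) /\ mesh (l1 ++ l2) < dt.
  split; first by split; rewrite ?cat_path ?last_cat E1 ?p1 ?E2.
  rewrite mesh_ltP// zipE all_cat; apply/andP.
  by split; [apply: sub_all a1|apply: sub_all a2] => p; rewrite lt_min => /andP[].
rewrite chain_sum_cat E1 => B2.
have := chain_sum_bound s0 (path_ltW p2); rewrite E2 => /(_ tT) B3.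
have -> : It - Is - A s t = (It - (chain_sum A 0 l1 + chain_sum A s l2))
  - (Is - chain_sum A 0 l1) + (chain_sum A s l2 - A s t) by ring.
rewrite (le_trans (ler_normD _ _))// addrC lerD// (le_trans (ler_normB _ _))//.
by rewrite [leRHS]splitr lerD// ltW.
Qed.

End AlmostAdditive.
End Sewing.

(** * Forests and cuts *)

Section ForestTheory.
Variable A : countType.
Implicit Types h g : forest A.

Lemma fsize_seq h :
  fsize h = sumn (map (fun t : tree A => psize (planar t)) (tree_seq h)).
Proof.
rewrite sumnE big_map /tree_seq big_flatten big_map.
by apply: eq_bigr => t _; rewrite big_nseq iter_addn_0 mulnC.
Qed.

Lemma perm_tree_seq h (ts : seq (tree A)) :
  (forall t, h t = count_mem t ts) -> perm_eq (tree_seq h) ts.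
Proof.
by move=> H; apply/allP => t _ /=; rewrite count_tree_seq H.
Qed.

Lemma fsize1 : fsize (mone : forest A) = 0%N.
Proof. by rewrite /fsize mdom1 big_nil. Qed.

Lemma fsizeM h1 h2 : fsize (mmul h1 h2) = (fsize h1 + fsize h2)%N.
Proof.
have/(perm_map (fun t : tree A => psize (planar t)))/perm_sumn :
    perm_eq (tree_seq (mmul h1 h2)) (tree_seq h1 ++ tree_seq h2).
  by apply: perm_tree_seq => t; rewrite count_cat !count_tree_seq cmM.
by rewrite map_cat sumn_cat -!fsize_seq.
Qed.

Lemma fsize_tree (t : tree A) : fsize (tree_forest t) = psize (planar t).
Proof. by rewrite /fsize mdomU big_seq_fset1 cmUU mul1n. Qed.

Lemma psize_canon (t : ptree A) : psize (Defs.canon t) = psize t.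
Proof.
elim/ptree_seq_ind: t => a ts H /=; congr _.+1.
rewrite (perm_sumn (perm_map _ (permEl (perm_sort _ _)))) -map_comp.
by congr sumn; elim: ts H => //= t ts IH [-> /IH ->].
Qed.

Lemma fsize_graft (a : A) h : fsize (graft a h) = (fsize h).+1.
Proof. by rewrite /graft fsize_tree psize_canon /= fsize_seq -map_comp. Qed.

Lemma fsize_eq0 h : fsize h = 0%N -> h = mone.
Proof.
move=> h0; apply/eqP/cmP => t; rewrite cm1; apply/eqP; rewrite cmE_eq0.
apply/negP => th; move: h0; rewrite /fsize (big_fsetD1 t)//=.
move: th; rewrite -cmE_neq0; case: (planar t) => a ts /=; lia.
Qed.

(** Induction on the underlying planar tree: the subtrees of a canonical tree are canonical, so they
    form a forest whose grafting is the given tree. *)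
Lemma forest_ind (P : forest A -> Prop) :
  P mone -> (forall h1 h2, P h1 -> P h2 -> P (mmul h1 h2)) ->
  (forall a h, P h -> P (graft a h)) -> forall h, P h.
Proof.
move=> P1 PM PG.
(* A list of trees satisfying [P] is, up to order, the list of a forest satisfying [P]. *)
have PS (ts : seq (tree A)) : (forall t, t \in ts -> P (tree_forest t)) ->
    exists2 h, P h & perm_eq (tree_seq h) ts.
  elim: ts => [|t ts IH] H.
    by exists mone => //; apply: perm_tree_seq => t; rewrite cm1.
  case: IH => [u uts|h Ph /permP hts]; first by apply: H; rewrite inE uts orbT.
  exists (mmul (tree_forest t) h); first by apply: PM => //; apply: H; exact: mem_head.
  by apply: perm_tree_seq => u; rewrite cmM /= cmU -hts count_tree_seq.
have PT (t : tree A) : P (tree_forest t).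
  case: t => pt; elim/ptree_seq_ind: pt => a ts H /[dup] /eqP [E] ct.
  have cts : map (@Defs.canon A) ts = ts.
    apply: map_id_in => u; rewrite -E mem_sort => /mapP[v _ ->]; exact: canonK.
  pose us := map (@Defs.tree_of A) ts.
  have usE : map (@planar A) us = ts by rewrite -map_comp -[RHS]cts.
  have [h Ph pe] : exists2 h, P h & perm_eq (tree_seq h) us.
    apply: PS => _ /mapP[u uts ->]; elim: ts {E ct us usE} cts H uts => //= v ts IH.
    move=> [cv cts] [Hv Hts]; rewrite inE => /predU1P[->|]; last exact: IH.
    suff <- : Tree (introT eqP cv) = Defs.tree_of v by apply: Hv.
    by apply: val_inj; rewrite /= cv.
  (* The subtrees of [h] agree with [ts] up to order, and sorting for an antisymmetric order removes
     the difference. *)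
  suff <- : graft a h = tree_forest (Tree ct) by exact: PG.
  congr ucm; apply: val_inj => /=; congr PNode; rewrite -[RHS]E.
  apply/perm_sortP; [exact: ptree_le_total|exact: ptree_le_trans|exact: ptree_le_anti|].
  by rewrite -[in X in perm_eq _ X]usE; do 2 apply: perm_map.
move=> h; suff /PS[h' Ph' E] : forall t, t \in tree_seq h -> P (tree_forest t).
  suff <- : h' = h by [].
  by apply/eqP/cmP => t; rewrite -!count_tree_seq; exact: permP E _.
by move=> t _.
Qed.
End ForestTheory.

Local Notation basis := Defs.basis.

(** * The coproduct of a forest as a list of cuts *)

Section Cuts.
Variables (R : realType) (A : countType).
Implicit Types h g : forest A.
Local Notation cutseq := (seq (forest A * forest A)).

Lemma tensorM (h1 h2 g1 g2 : forest A) :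
  tensor R h1 h2 * tensor R g1 g2 = tensor R (mmul h1 g1) (mmul h2 g2).
Proof. by rewrite malgM_def fgmulUU mulr1. Qed.

(** [id_graft] is defined through the support of its argument; reading it as an [mmap] gives
    additivity, even when pairs repeat. *)
Lemma id_graft_sum (a : A) (s : cutseq) :
  id_graft a (\sum_(p <- s) tensor R p.1 p.2) =
  \sum_(p <- s) tensor R p.1 (graft a p.2).
Proof.
have E w : id_graft a w =
    mmap (mkmalgU mone) (fun p => tensor R p.1 (graft a p.2)) w.
  by apply: eq_bigr => p _; rewrite mul_malgC.
rewrite E raddf_sum; apply: eq_bigr => p _ /=.
by rewrite mmapU mul_malgC scale1r.
Qed.

Lemma mcoeff_basis h g : mcoeff g (basis R h) = (h == g)%:R.
Proof. exact: mcoeffU. Qed.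

(* The last clause says that 1 (x) h is the only term of the coproduct of h whose
   left factor is 1. *)
Definition cut_spec h (s : cutseq) : Prop :=
  [/\ coproduct (basis R h) = \sum_(p <- s) tensor R p.1 p.2,
      forall p, p \in s -> (fsize p.1 + fsize p.2)%N = fsize h,
      (size s <= 2 ^ fsize h)%N
    & forall f : forest A -> R, \sum_(p <- s | p.1 == mone) f p.2 = f h].

(** Cuts of a product are products of cuts. Cuts of [[h]_a] are those of [h] with the right factor
    grafted, together with the full cut [([h]_a, 1)]; their number is at most [2^|h| + 1]. *)
Lemma cut_exists h : exists s, cut_spec h s.
Proof.
elim/forest_ind: h => [|h1 h2 [s1 [E1 g1 n1 c1]] [s2 [E2 g2 n2 c2]]|a h [s [E gr n c]]].
- exists [:: (mone, mone)]; split.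
  + by rewrite big_seq1 coproduct_basis coproduct_forest1.
  + by move=> p; rewrite inE => /eqP -> /=; rewrite fsize1.
  + by rewrite fsize1.
  + by move=> f; rewrite big_cons big_nil /= eqxx addr0.
- exists [seq pair_mul p q | p <- s1, q <- s2]; split.
  + rewrite coproduct_basis coproduct_forestM -(coproduct_basis R h1) E1.
    rewrite -(coproduct_basis R h2) E2.
    rewrite big_allpairs_dep mulr_suml; apply: eq_bigr => p _.
    by rewrite mulr_sumr; apply: eq_bigr => q _; rewrite tensorM.
  + move=> _ /allpairsP[[p q] /= [/g1 pE /g2 qE ->]].
    by rewrite !fsizeM addnACA pE qE.
  + by rewrite size_allpairs fsizeM expnD leq_mul.
  (* A product of left factors is empty only if both factors are. *)
  + move=> f; rewrite big_mkcond big_allpairs_dep /=.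
    rewrite -(c1 (fun g => f (mmul g h2))) [RHS]big_mkcond /=.
    apply: eq_bigr => p _; rewrite -(c2 (fun g => f (mmul p.2 g))).
    case: eqP => p1.
      by rewrite [RHS]big_mkcond; apply: eq_bigr => q _; rewrite p1 mul1m.
    by rewrite big1// => q _; case: eqP => // /unitm[/p1].
- exists ((graft a h, mone) :: [seq (p.1, graft a p.2) | p <- s]); split.
  + by rewrite coproduct_graft E id_graft_sum big_cons big_map addrC.
  + move=> p; rewrite inE fsize_graft => /predU1P[->|/mapP[q /gr <- ->]] /=.
      by rewrite fsize_graft fsize1 addn0.
    by rewrite fsize_graft addnS.
  + rewrite /= size_map fsize_graft expnS mul2n -addnn.
    by rewrite -addn1 leq_add// expn_gt0.
  + move=> f; rewrite big_cons big_map /=.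
    by case: eqP => [/graft_neq_one//|_]; rewrite (c (fun g => f (graft a g))).
Qed.

(** Multiplicities in the coproduct appear as repeated pairs, so sums over cuts carry no
    coefficients. *)
Definition cuts h : cutseq := projT1 (cid (cut_exists h)).

Lemma cutsP h : cut_spec h (cuts h).
Proof. exact: projT2 (cid (cut_exists h)). Qed.

Lemma fsize_cut h p : p \in cuts h -> (fsize p.1 + fsize p.2)%N = fsize h.
Proof. by have [_ + _ _] := cutsP h; exact. Qed.

Lemma size_cuts h : (size (cuts h) <= 2 ^ fsize h)%N.
Proof. by have [] := cutsP h. Qed.

Lemma sum_cuts_counit h (f : forest A -> R) :
  \sum_(p <- cuts h | p.1 == mone) f p.2 = f h.
Proof. by have [] := cutsP h. Qed.

Section Star.
Variables phi psi : hopf R A -> R.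
Local Notation F := (fun p => phi (basis R p.1) * psi (basis R p.2)).

Lemma starE x : star phi psi x = mmap idfun F (coproduct x).
Proof. by []. Qed.

Lemma star_basis h : star phi psi (basis R h) = \sum_(p <- cuts h) F p.
Proof.
have [E _ _ _] := cutsP h; rewrite starE E raddf_sum; apply: eq_bigr => p _ /=.
by rewrite mmapU mul1r.
Qed.

Lemma star_graft (a : A) h : star phi psi (basis R (graft a h)) =
  \sum_(p <- cuts h) phi (basis R p.1) * psi (basis R (graft a p.2))
  + phi (basis R (graft a h)) * psi (basis R mone).
Proof.
have [E _ _ _] := cutsP h.
rewrite starE coproduct_graft E id_graft_sum mmapD raddf_sum mmapU mul1r.
by congr (_ + _); apply: eq_bigr => p _ /=; rewrite mmapU mul1r.
Qed.

Lemma star_one : star phi psi (basis R mone) =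
  phi (basis R mone) * psi (basis R mone).
Proof.
have E : coproduct (basis R (mone : forest A)) = tensor R mone mone.
  by rewrite coproduct_basis coproduct_forest1.
by rewrite starE E mmapU mul1r.
Qed.

Lemma star_is_linear : scalar (star phi psi).
Proof.
move=> c x y; rewrite !starE coproduct_is_linear mmapD; congr (_ + _).
rewrite (mmapEw (msuppZ_le _ _)) mmapE mulr_sumr.
by apply: eq_bigr => p _; rewrite mcoeffZ; exact/esym/mulrA.
Qed.

Lemma star_sum (I : Type) (r : seq I) (P : pred I) (c : I -> R) (x : I -> hopf R A) :
  star phi psi (\sum_(i <- r | P i) c i *: x i) =
  \sum_(i <- r | P i) c i * star phi psi (x i).
Proof.
elim/big_rec2: _ => [|i u v _ <-]; last by rewrite star_is_linear.
(* Linearity with coefficient -1 gives the value 0 at 0. *)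
by have := star_is_linear (-1) 0 0; rewrite scaler0 add0r mulN1r addNr.
Qed.

End Star.
End Cuts.

(** * Rough integrals *)

Section Holder.
Variables (R : realType) (T : R).
Hypothesis T_gt0 : 0 < T.
Implicit Types F : R -> R -> R.

(** The pair [(0, T)] makes the supremum one over a nonempty set; over the empty set it would be
    [-oo]. *)
Lemma holder_ge0 gamma F : (0 <= holder T gamma F)%E.
Proof.
have T0 := T_gt0; apply: (@le_trans _ _ (`|F 0 T| / `|T - 0| `^ gamma)%:E).
  by rewrite lee_fin divr_ge0// powR_ge0.
apply: ereal_sup_ubound; exists (0, T) => //=.
by rewrite !in_itv /= !lexx (ltW T0); split=> //; rewrite lt_eqF.
Qed.

Lemma holder_bound gamma F : (holder T gamma F < +oo)%E ->
  forall s t, 0 <= s <= T -> 0 <= t <= T -> s != t ->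
  `|F s t| <= fine (holder T gamma F) * `|t - s| `^ gamma.
Proof.
move=> fin s t sT tT st.
rewrite -ler_pdivrMr; last by rewrite powR_gt0// normr_gt0 subr_eq0 eq_sym.
rewrite -lee_fin fineK ?ge0_fin_numE ?holder_ge0//.
by apply: ereal_sup_ubound; exists (s, t) => //=; split=> //; rewrite in_itv.
Qed.

Lemma holder_le gamma F (C : R) :
  (forall s t, 0 <= s <= T -> 0 <= t <= T -> s != t ->
    `|F s t| <= C * `|t - s| `^ gamma) ->
  (holder T gamma F <= C%:E)%E.
Proof.
move=> H; apply: ge_ereal_sup => _ [[s t] /= [sT tT st] <-].
rewrite lee_fin ler_pdivrMr; last by rewrite powR_gt0// normr_gt0 subr_eq0 eq_sym.
by apply: H; rewrite -?in_itv.
Qed.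

End Holder.

Lemma level_gt0 (R : realType) (alpha : R) : 0 < alpha -> alpha < 1 ->
  (0 < level alpha)%N.
Proof.
move=> a0 a1; rewrite /level truncn_gt0; by rewrite ltW// invf_gt1.
Qed.

(** Final arithmetic, with [c] the sewing constant, [M = 2^N], [t = T^alpha], [x] the bound on [X],
    [v] the sum of the [|Z^h_0|] and [u] that of the bounds on the [R^h]. The difference of the two
    sides has nonnegative coefficients. *)
Lemma norm_polynomial_bound (R : realType) (c M t x v u : R) :
  0 <= c -> 0 <= M -> 0 <= t -> 0 <= x -> 0 <= v -> 0 <= u ->
  (c + 1) * (x * u) * t + x * (v + t * u) + (v + t * u + x * M * (v + t * u))
  <= (c + 2 + M) * (1 + t) * (1 + x) * (v + u).
Proof.
move=> c0 M0 t0 x0 v0 u0; rewrite -subr_ge0; set D := c + 2 + M.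
have -> : D * (1 + t) * (1 + x) * (v + u) -
   ((c + 1) * (x * u) * t + x * (v + t * u) + (v + t * u + x * M * (v + t * u))) =
   D * (u + t * v + x * u + x * t * v) + (D - 1) * (v + t * u) + (c + 1) * x * v.
  by rewrite /D; ring.
have D1 : 0 <= D - 1 by rewrite /D; lra.
have D0 : 0 <= D by lra.
have c1 : 0 <= c + 1 by lra.
move: (D - 1) (c + 1) D1 c1 => D' c' D'0 c'0; clearbody D.
by do ?[apply: addr_ge0|apply: mulr_ge0].
Qed.

(** * Chen's relation and the germ of the rough integral *)

Section RoughIntegral.
Variables (R : realType) (A : finType) (alpha T : R).
Variables (X : R -> R -> hopf R A -> R) (Z : R -> hopf R A) (a : A).
Hypotheses (T_gt0 : 0 < T) (alpha_gt0 : 0 < alpha) (alpha_lt1 : alpha < 1).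
Hypothesis X_rough : branched_rough_path alpha T X.

Local Notation N := (level alpha).
Local Notation F := (fset_set (@forests A N.-1)).
Local Notation Xc h s t := (X s t (basis R h)).
Local Notation Zc h t := (mcoeff h (Z t)).

Hypothesis Z_supp :
  forall t, t \in `[0, T] -> [set` msupp (Z t)] `<=` @forests A N.-1.

Lemma mem_forests h : (h \in F) = (fsize h <= N.-1)%N.
Proof.
by rewrite in_fset_set; [apply/asboolP/idP|exact: finite_forests].
Qed.

Lemma msupp_Z_sub t : 0 <= t <= T -> (msupp (Z t) `<=` F)%fset.
Proof.
move=> tT; apply/fsubsetP => h hZ; rewrite mem_forests.
by apply: (@Z_supp t); rewrite ?in_itv.
Qed.

Lemma Z_decomp t : 0 <= t <= T -> Z t = \sum_(l <- F) Zc l t *: basis R l.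
Proof.
move=> tT; rewrite [LHS](@monalgEw _ _ _ F).
  apply: eq_bigr => l _; apply/malgP => k.
  by rewrite mcoeffU mcoeffZ mcoeffU mulr_natr.
exact: msupp_Z_sub.
Qed.

Lemma star_Z phi psi s : 0 <= s <= T -> star phi psi (Z s) =
  \sum_(l <- F) Zc l s *
    \sum_(p <- cuts R l) phi (basis R p.1) * psi (basis R p.2).
Proof.
move=> sT; rewrite [in LHS](Z_decomp sT) star_sum.
by apply: eq_bigr => l _; rewrite star_basis.
Qed.

(** Pairing with the functional [k] on the right selects the cuts with right factor [k]. *)
Lemma remainderE k s t : 0 <= s <= T -> remainder X Z k s t =
  Zc k t - \sum_(l <- F) Zc l s * \sum_(p <- cuts R l | p.2 == k) Xc p.1 s t.
Proof.
move=> sT; rewrite /remainder star_Z//; congr (_ - _).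
apply: eq_bigr => l _; congr (_ * _); rewrite [RHS]big_mkcond /=.
by apply: eq_bigr => p _; rewrite mcoeffU; case: eqP; rewrite ?mulr1 ?mulr0.
Qed.

Lemma X_one s t : 0 <= s <= T -> 0 <= t <= T -> Xc mone s t = 1.
Proof.
move=> sT tT; have [ch _ _] := X_rough.
by have [||_ + _] := ch s t; rewrite ?in_itv.
Qed.

Lemma chen s u t h : 0 <= s <= T -> 0 <= u <= T -> 0 <= t <= T ->
  Xc h s t = star (X s u) (X u t) (basis R h).
Proof.
by move=> sT uT tT; have [_ ch _] := X_rough; rewrite ch ?in_itv.
Qed.

Lemma chen_graft s u t h : 0 <= s <= T -> 0 <= u <= T -> 0 <= t <= T ->
  Xc (graft a h) s t =
  \sum_(p <- cuts R h) Xc p.1 s u * Xc (graft a p.2) u t + Xc (graft a h) s u.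
Proof.
move=> sT uT tT; apply: etrans (chen _ sT uT tT) _.
apply: etrans (star_graft _ _ _ _) _; congr (_ + _).
by rewrite X_one// mulr1.
Qed.

(** The step goes towards the farther endpoint, so that it stays inside even when [s] is 0 or
    [T]. *)
Lemma near_in_interval s d : 0 <= s <= T -> 0 < d ->
  exists u, [/\ 0 <= u <= T, s != u & `|u - s| <= d].
Proof.
move=> /andP[s0 sT] d0; have T0 := T_gt0.
pose e := Num.min d (T / 2).
have e0 : 0 < e by rewrite lt_min d0 divr_gt0.
have ed : e <= d by rewrite ge_min lexx.
have eT : e <= T / 2 by rewrite ge_min lexx orbT.
have [sT2|Ts2] := leP s (T / 2).
  exists (s + e); rewrite addrAC subrr add0r (gtr0_norm e0).
  by split; [lra|apply/eqP => ?; lra|].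
exists (s - e); rewrite addrAC subrr add0r normrN (gtr0_norm e0).
by split; [lra|apply/eqP => ?; lra|].
Qed.

Lemma alphaMn_gt0 n : (0 < n)%N -> 0 < alpha *+ n.
Proof. by move=> n0; rewrite pmulrn_rgt0. Qed.

(* By Chen's relation and the bounds on X, |X_ss(h)| = O(|u - s|^(alpha |h|))
   for every u. *)
Lemma X_diag s h : 0 <= s <= T -> fsize h != 0%N -> Xc h s s = 0.
Proof.
move=> sT h0; have [_ _ hX] := X_rough.
pose K g := fine (holder T (alpha *+ fsize g) (fun s t => Xc g s t)).
have K0 g : 0 <= K g by rewrite fine_ge0// holder_ge0.
pose M := \sum_(p <- cuts R h) K p.1 * K p.2.
have M0 : 0 <= M by apply: sumr_ge0 => p _; rewrite mulr_ge0.
apply/eqP; rewrite -normr_le0; apply/ler_addgt0Pr => e e0; rewrite add0r.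
have p0 : 0 < alpha *+ fsize h by rewrite alphaMn_gt0// lt0n.
have [d d0 Md] := small_powR M0 e0 p0.
have [u [uT su ud]] := near_in_interval sT d0.
rewrite (chen _ sT uT sT) star_basis (le_trans (ler_norm_sum _ _ _))//.
apply: le_trans (ltW Md); rewrite mulr_suml big_seq [leRHS]big_seq.
apply: ler_sum => p ph; rewrite normrM.
have us : 0 < `|u - s| by rewrite normr_gt0 subr_eq0 eq_sym.
apply: (@le_trans _ _ (K p.1 * `|u - s| `^ (alpha *+ fsize p.1) *
                       (K p.2 * `|u - s| `^ (alpha *+ fsize p.2)))).
  apply: ler_pM => //; first exact: holder_bound.
  by rewrite (distrC u s); apply: holder_bound; rewrite // eq_sym.
rewrite mulrACA -powRD ?(gt_eqF us) ?implybT// -mulrnDr (fsize_cut ph).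
by rewrite ler_wpM2l ?mulr_ge0// ge0_ler_powR// ?nnegrE ?(ltW p0) ?(ltW d0).
Qed.

Definition germ (s t : R) : R := \sum_(h <- F) Zc h s * Xc (graft a h) s t.

Lemma germ_diag s : 0 <= s <= T -> germ s s = 0.
Proof.
move=> sT; rewrite /germ big1// => h _.
by rewrite X_diag ?mulr0// fsize_graft.
Qed.

(** In Chen's relation for [[l]_a] the full cuts add up to [germ s u]. The other cuts, grouped by
    their right factor [k], give [<X_(s,u) * k, Z_s>] as the coefficient of [X^([k]_a)_(u,t)]. *)
Lemma germ_delta s u t : 0 <= s <= T -> 0 <= u <= T -> 0 <= t <= T ->
  germ s t - germ s u - germ u t =
  - \sum_(k <- F) remainder X Z k s u * Xc (graft a k) u t.
Proof.
move=> sT uT tT.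
have -> : \sum_(k <- F) remainder X Z k s u * Xc (graft a k) u t =
    germ u t - \sum_(l <- F) Zc l s *
      \sum_(p <- cuts R l) Xc p.1 s u * Xc (graft a p.2) u t.
  under eq_bigr => k _ do rewrite remainderE// mulrBl.
  rewrite sumrB; congr (_ - _).
  under eq_bigr => k _ do rewrite mulr_suml.
  rewrite exchange_big /= big_seq [RHS]big_seq; apply: eq_bigr => l lF.
  under eq_bigr => k _ do rewrite -mulrA mulr_suml big_mkcond.
  rewrite -mulr_sumr exchange_big /= big_seq [in RHS]big_seq.
  congr (_ * _); apply: eq_bigr => p pl.
  (* A right factor is no larger than the forest cut, so it is again indexed by [F]. *)
  rewrite (big_fsetD1 p.2) /=; last first.
    move: lF; rewrite !mem_forests -(fsize_cut pl); apply: leq_trans.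
    exact: leq_addl.
  rewrite eqxx big_seq big1 ?addr0// => k; rewrite !inE eq_sym.
  by case/andP => /negPf ->.
have -> : germ s t = germ s u + \sum_(l <- F) Zc l s *
      \sum_(p <- cuts R l) Xc p.1 s u * Xc (graft a p.2) u t.
  rewrite -big_split; apply: eq_bigr => h _ /=.
  by rewrite (chen_graft _ sT uT tT) mulrDr addrC.
by rewrite opprB [X in X - germ u t]addrAC subrr add0r.
Qed.

Lemma rough_integralE t : rough_integral alpha X Z a t =
  lim (chain_sum germ 0 @ mesh_filter t).
Proof.
rewrite /rough_integral; congr (lim (_ @ mesh_filter t)).
apply/funext => s; apply: eq_bigr => p _.
by rewrite fsbig_finite//; exact: finite_forests.
Qed.


(** * Sewing the germ, with real numbers bounding the seminorms of [X] and of the remainders *)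

Variables (x : R) (r : forest A -> R).
Hypotheses (x_ge0 : 0 <= x) (r_ge0 : forall h, 0 <= r h).
Hypothesis X_bound : forall h, (0 < fsize h <= N)%N ->
  forall s t : R, 0 <= s <= T -> 0 <= t <= T -> s != t ->
  `|Xc h s t| <= x * `|t - s| `^ (alpha *+ fsize h).
Hypothesis R_bound : forall h, h \in F ->
  forall s t : R, 0 <= s <= T -> 0 <= t <= T -> s != t ->
  `|remainder X Z h s t| <= r h * `|t - s| `^ (alpha *+ (N - fsize h)).

Let theta := alpha *+ N.+1.
Let K := x * \sum_(h <- F) r h.
Let c := sewing_const theta.

(** [N] is the integer part of [1 / alpha], so [N + 1 > 1 / alpha]. *)
Lemma theta_gt1 : 1 < theta.
Proof.
rewrite /theta -mulr_natr -ltr_pdivrMl// mulr1; exact: truncnS_gt.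
Qed.

Lemma K_ge0 : 0 <= K.
Proof. by rewrite mulr_ge0// sumr_ge0. Qed.

Lemma alphaMn_ge0 n : 0 <= alpha *+ n.
Proof. by rewrite mulrn_wge0// ltW. Qed.

Lemma powR_le (u v : R) n : 0 <= u -> u <= v ->
  u `^ (alpha *+ n) <= v `^ (alpha *+ n).
Proof.
by move=> u0 uv; rewrite ge0_ler_powR ?nnegrE ?alphaMn_ge0 ?(le_trans u0).
Qed.

Lemma powR_alphaD (u : R) m n : 0 < u ->
  u `^ (alpha *+ (m + n)) = u `^ (alpha *+ m) * u `^ (alpha *+ n).
Proof. by move=> u0; rewrite mulrnDr powRD// (gt_eqF u0) implybT. Qed.

Lemma fsize_lt_level h : h \in F -> (fsize h < N)%N.
Proof.
have := level_gt0 alpha_gt0 alpha_lt1; rewrite mem_forests; lia.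
Qed.

(** The exponents [N - |h|] and [|h| + 1] add up to [N + 1]. No order of the times is assumed, so
    that [t = s] is allowed in [rough_integral_bound]. *)
Lemma germ_delta_bound s u t (L : R) :
  0 <= s <= T -> 0 <= u <= T -> 0 <= t <= T -> s != u -> u != t ->
  `|u - s| <= L -> `|t - u| <= L ->
  `|germ s t - germ s u - germ u t| <= K * L `^ theta.
Proof.
move=> sT uT tT su ut suL utL; rewrite germ_delta// normrN.
rewrite (le_trans (ler_norm_sum _ _ _))// /K mulrAC mulr_sumr.
rewrite big_seq [leRHS]big_seq; apply: ler_sum => h hF; rewrite normrM.
have hN := fsize_lt_level hF.
have L0 : 0 < L by apply: lt_le_trans suL; rewrite normr_gt0 subr_eq0 eq_sym.
apply: (@le_trans _ _ ((r h * L `^ (alpha *+ (N - fsize h))) *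
                       (x * L `^ (alpha *+ (fsize h).+1)))).
  apply: ler_pM => //.
    by apply: le_trans (R_bound hF sT uT su) _; rewrite ler_wpM2l // powR_le.
  rewrite -(fsize_graft a h).
  apply: (le_trans (X_bound _ uT tT ut)); first by rewrite fsize_graft.
  by rewrite ler_wpM2l // powR_le.
rewrite mulrACA -powR_alphaD// [r h * x]mulrC mulrAC.
suff -> : (N - fsize h + (fsize h).+1)%N = N.+1 by [].
by rewrite addnS subnK// ltnW.
Qed.

Lemma germ_almost_additive s u t : 0 <= s -> s <= u -> u <= t -> t <= T ->
  `|germ s t - germ s u - germ u t| <= K * (t - s) `^ theta.
Proof.
move=> s0 su ut tT.
have sT : 0 <= s <= T by rewrite s0 (le_trans su)// (le_trans ut).
have uT : 0 <= u <= T by rewrite (le_trans s0)// (le_trans ut).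
have {}tT : 0 <= t <= T by rewrite tT (le_trans s0)// (le_trans su).
have K0 : 0 <= K * (t - s) `^ theta by rewrite mulr_ge0 ?powR_ge0 ?K_ge0.
have [<-|su'] := eqVneq s u.
  by rewrite (germ_diag sT) subr0 subrr normr0.
have [->|ut'] := eqVneq u t.
  by rewrite (germ_diag tT) subr0 subrr normr0.
apply: germ_delta_bound => //; rewrite ger0_norm; lra.
Qed.

Local Notation I t := (rough_integral alpha X Z a t).

Lemma rough_integral0 : I 0 = 0.
Proof. by rewrite rough_integralE lim_chain_sum0. Qed.

(** Sewing covers [s <= t]. For [t < s] the times are exchanged at the cost of the defect of the
    triple [s, t, s], whence [c + 1]. *)
Lemma rough_integral_bound s t : 0 <= s <= T -> 0 <= t <= T -> s != t ->
  `|I t - I s - germ s t| <= (c + 1) * K * `|t - s| `^ theta.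
Proof.
have sew := sewing theta_gt1 K_ge0 germ_diag germ_almost_additive.
have K0 := K_ge0.
have wlg s' t' : 0 <= s' <= T -> 0 <= t' <= T -> s' <= t' ->
    `|I t' - I s' - germ s' t'| <= c * K * `|t' - s'| `^ theta.
  move=> /andP[s0 sT] /andP[t0 tT] st; rewrite !rough_integralE.
  by rewrite (ger0_norm (_ : 0 <= t' - s')) ?subr_ge0//; apply: sew.
move=> sT tT st.
have P0 : 0 <= K * `|t - s| `^ theta by rewrite mulr_ge0 ?powR_ge0.
rewrite -mulrA mulrDl mul1r mulrA.
have [st'|ts] := leP s t.
  by apply: le_trans (wlg _ _ sT tT st') _; rewrite lerDl.
have -> : I t - I s - germ s t = - (I s - I t - germ t s)
   + (germ s s - germ s t - germ t s) by rewrite (germ_diag sT); ring.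
rewrite (le_trans (ler_normD _ _))// normrN lerD//.
  by rewrite (distrC t s) wlg// ltW.
by apply: germ_delta_bound; rewrite // ?(distrC s t)// eq_sym.
Qed.

(** * Remainders of the integrated path *)

Local Notation J := (rough_integration alpha X Z a).
(* The components of Z that the integral keeps. *)
Local Notation low := (fun l : forest A => (fsize l + 2 <= N)%N).

Lemma star_J psi s t : 0 <= s <= T -> 0 <= t <= T ->
  star (X s t) psi (J s) = I s * psi (basis R mone) +
  \sum_(l <- F | low l) Zc l s *
    (\sum_(p <- cuts R l) Xc p.1 s t * psi (basis R (graft a p.2)) +
     Xc (graft a l) s t * psi (basis R mone)).
Proof.
move=> sT tT; rewrite /rough_integration star_is_linear.
congr (_ * _ + _); first by rewrite star_one X_one// mul1r.
rewrite star_sum big_mkcond [RHS]big_mkcond.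
transitivity (\sum_(l <- F) if low l then
   Zc l s * star (X s t) psi (basis R (graft a l)) else 0).
  apply: big_fset_incl (msupp_Z_sub sT) _ => l _ /mcoeff_outdom ->.
  by rewrite mul0r if_same.
apply: eq_bigr => l _; case: ifP => // _; congr (_ * _); exact: star_graft.
Qed.

(** One formula for every [g]: the tests [mone == g] carry the integral and the full cuts, whose
    right factor is empty. *)
Lemma remainder_JE g s t : 0 <= s <= T -> 0 <= t <= T ->
  remainder X J g s t = mcoeff g (J t) - ((if mone == g then I s else 0) +
  \sum_(l <- F | low l) Zc l s *
    (\sum_(p <- cuts R l | graft a p.2 == g) Xc p.1 s t +
     (if mone == g then Xc (graft a l) s t else 0))).
Proof.
have E (y : R) h : y * mcoeff g (basis R h) = if h == g then y else 0.
  apply: etrans (congr1 (fun z => y * z) (mcoeff_basis R h g)) _.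
  by case: (h == g); rewrite ?mulr1 ?mulr0.
move=> sT tT; congr (_ - _); apply: etrans (star_J _ sT tT) _.
congr (_ + _); first exact: E.
apply: eq_bigr => l _; congr (_ * (_ + _)); last exact: E.
rewrite [RHS]big_mkcond; apply: eq_bigr => p _; exact: E.
Qed.

Lemma one_neq_graft h : (mone == graft a h) = false.
Proof. by rewrite eq_sym; apply/eqP; exact: graft_neq_one. Qed.

Lemma remainder_one s t : 0 <= s <= T -> 0 <= t <= T ->
  remainder X J mone s t =
  I t - I s - \sum_(l <- F | low l) Zc l s * Xc (graft a l) s t.
Proof.
move=> sT tT; rewrite remainder_JE// mcoeff_rough_integration_one.
rewrite eqxx opprD addrA; congr (_ - _); apply: eq_bigr => l _.
by rewrite big_pred0 ?add0r// => p; rewrite eq_sym one_neq_graft.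
Qed.

Lemma remainder_graft k s t : 0 <= s <= T -> 0 <= t <= T -> low k ->
  remainder X J (graft a k) s t =
  Zc k t - \sum_(l <- F | low l)
    Zc l s * \sum_(p <- cuts R l | p.2 == k) Xc p.1 s t.
Proof.
move=> sT tT kN; rewrite remainder_JE// mcoeff_rough_integration_graft kN.
rewrite one_neq_graft add0r; congr (_ - _).
apply: eq_bigr => l _; congr (_ * _); rewrite addr0.
by apply: eq_bigl => p; rewrite (inj_eq (@graft_inj _ a)).
Qed.

Lemma remainder_other g s t : 0 <= s <= T -> 0 <= t <= T ->
  g <> mone -> (forall k, g <> graft a k) -> remainder X J g s t = 0.
Proof.
move=> sT tT g1 ga; rewrite remainder_JE// mcoeff_rough_integration_other//.
have -> : (mone == g) = false by apply/eqP => /esym.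
rewrite big1 ?addr0 ?subr0// => l _; rewrite addr0 big_pred0 ?mulr0// => p.
by apply/eqP => /esym; exact: ga.
Qed.

(** A bound for [Z^l] when [|l| = N - 1], by [Z_top_bound]; it is defined for every [l] so that sums
    can run over all of [F]. *)
Let b (l : forest A) := `|Zc l 0| + T `^ alpha * r l.

Lemma b_ge0 l : 0 <= b l.
Proof. by rewrite addr_ge0// mulr_ge0// powR_ge0. Qed.

(* Forests of maximal size only occur on the right of the coproduct of a forest
   of size at most N - 1 through the term 1 (x) l, so that R^l is an increment. *)
Lemma Z_top_bound l t : l \in F -> ~~ low l -> 0 <= t <= T -> `|Zc l t| <= b l.
Proof.
move=> lF lN tT.
have z0 : 0 <= `|Zc l 0| by [].
have Tr0 : 0 <= T `^ alpha * r l by rewrite mulr_ge0// powR_ge0.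
have T0 : 0 <= (0 : R) <= T by rewrite lexx ltW.
have [->|t0] := eqVneq t 0; first by rewrite /b lerDl.
have : `|remainder X Z l 0 t| <= T `^ alpha * r l.
  apply: (le_trans (R_bound lF T0 tT _)); first by rewrite eq_sym.
  rewrite mulrC ler_wpM2r// subr0.
  have -> : (N - fsize l)%N = 1%N.
    by move: lN (fsize_lt_level lF); move: (fsize l) N; clear; lia.
  by move: tT => /andP[t0' tT']; rewrite ger0_norm// powR_le.
rewrite remainderE//.
have -> : \sum_(k <- F) Zc k 0 * \sum_(p <- cuts R k | p.2 == l) Xc p.1 0 t =
    Zc l 0.
  transitivity (\sum_(k <- F) if k == l then Zc l 0 else 0); last first.
    rewrite (big_fsetD1 l)//= eqxx [X in _ + X]big_seq big1 ?addr0// => k.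
    by rewrite !inE => /andP[/negPf ->].
  rewrite big_seq [RHS]big_seq; apply: eq_bigr => k kF.
  (* A cut of [k] with right factor [l] has a left factor of size 0, since [|k| <= N - 1 = |l|]; the
     counit property then evaluates the sum. *)
  have -> : \sum_(p <- cuts R k | p.2 == l) Xc p.1 0 t = if k == l then 1 else 0.
    rewrite -(sum_cuts_counit k (fun h => if h == l then 1 else 0)).
    rewrite big_mkcond [RHS]big_mkcond big_seq [RHS]big_seq.
    apply: eq_bigr => p pk /=; case: (eqVneq p.2 l) => [pl|_]; last by case: eqP.
    suff -> : p.1 = mone by rewrite eqxx X_one.
    apply: fsize_eq0; have := fsize_cut pk; rewrite pl.
    move: lN (fsize_lt_level lF) (fsize_lt_level kF).
    by move: (fsize l) (fsize k) (fsize p.1) N; clear; lia.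
  by case: eqP => [->|_]; rewrite ?mulr1 ?mulr0.
move=> H; rewrite /b -[Zc l t](subrKC (Zc l 0)).
by rewrite (le_trans (ler_normD _ _))// lerD.
Qed.

Let B := \sum_(l <- F) b l.

(** Adding and subtracting the terms with [|l| = N - 1] completes the germ. The sewing error has one
    power [|t - s|^alpha] to spare, bounded by [T^alpha]; the added terms involve trees [[l]_a] of
    size exactly [N]. *)
Lemma remainder_one_bound s t : 0 <= s <= T -> 0 <= t <= T -> s != t ->
  `|remainder X J mone s t| <=
  ((c + 1) * K * T `^ alpha + x * B) * `|t - s| `^ (alpha *+ N).
Proof.
move=> sT tT st; have ts0 : 0 < `|t - s| by rewrite normr_gt0 subr_eq0 eq_sym.
have tsT : `|t - s| <= T by move: sT tT; rewrite ler_norml; lra.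
have c0 : 0 < c := sewing_const_gt0 theta_gt1.
rewrite remainder_one//.
have -> : I t - I s - \sum_(l <- F | low l) Zc l s * Xc (graft a l) s t =
    (I t - I s - germ s t) +
    \sum_(l <- F | ~~ low l) Zc l s * Xc (graft a l) s t.
  by rewrite /germ [\sum_(h <- F) _](bigID low) /= opprD addrA subrK.
rewrite (le_trans (ler_normD _ _))// mulrDl lerD//.
  apply: (le_trans (rough_integral_bound sT tT st)).
  rewrite /theta -add1n powR_alphaD// mulrA ler_wpM2r ?powR_ge0//.
  rewrite ler_wpM2l ?powR_le//.
  by rewrite mulr_ge0 ?K_ge0// addr_ge0// ltW.
rewrite (le_trans (ler_norm_sum _ _ _))// mulrAC mulrC mulr_suml.
rewrite big_mkcond big_seq [leRHS]big_seq; apply: ler_sum => l lF.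
case: ifP => [lN|_]; last by rewrite mulr_ge0 ?b_ge0// mulr_ge0 ?powR_ge0.
rewrite normrM ler_pM//; first exact: Z_top_bound.
have E : fsize (graft a l) = N.
  rewrite fsize_graft; move: lN (fsize_lt_level lF).
  by move: (fsize l) N; clear; lia.
by rewrite -[in leRHS]E X_bound// E leqnn level_gt0.
Qed.

(** When [|l| = N - 1], a cut with right factor [k] has a left factor of size [N - |k| - 1], the
    required exponent. The number of such cuts is kept, to be summed over [k] later. *)
Lemma remainder_graft_bound k s t :
  0 <= s <= T -> 0 <= t <= T -> s != t -> low k ->
  `|remainder X J (graft a k) s t| <=
  (T `^ alpha * r k +
   \sum_(l <- F) b l * (x * (count (fun p => p.2 == k) (cuts R l))%:R)) *
  `|t - s| `^ (alpha *+ (N - fsize (graft a k))).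
Proof.
move=> sT tT st kN; have ts0 : 0 < `|t - s| by rewrite normr_gt0 subr_eq0 eq_sym.
have tsT : `|t - s| <= T by move: sT tT; rewrite ler_norml; lra.
have kF : k \in F.
  by rewrite mem_forests; move: kN; move: (fsize k) N; clear; lia.
rewrite remainder_graft// fsize_graft.
have -> : Zc k t - \sum_(l <- F | low l)
      Zc l s * \sum_(p <- cuts R l | p.2 == k) Xc p.1 s t =
    remainder X Z k s t + \sum_(l <- F | ~~ low l)
      Zc l s * \sum_(p <- cuts R l | p.2 == k) Xc p.1 s t.
  by rewrite remainderE// [\sum_(l <- F) _](bigID low) /= opprD addrA subrK.
rewrite (le_trans (ler_normD _ _))// mulrDl lerD//.
  apply: (le_trans (R_bound kF sT tT st)).
  rewrite [T `^ _ * _]mulrC -mulrA ler_wpM2l//.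
  have -> : (N - fsize k)%N = (1 + (N - (fsize k).+1))%N.
    by move: kN; move: (fsize k) N; clear; lia.
  by rewrite powR_alphaD// ler_wpM2r ?powR_ge0// powR_le.
rewrite (le_trans (ler_norm_sum _ _ _))// mulr_suml.
rewrite big_mkcond big_seq [leRHS]big_seq; apply: ler_sum => l lF.
case: ifP => [lN|_]; last by rewrite mulr_ge0 ?powR_ge0// mulr_ge0 ?b_ge0// mulr_ge0.
rewrite normrM -mulrA ler_pM//; first exact: Z_top_bound.
rewrite (le_trans (ler_norm_sum _ _ _))// mulrAC.
rewrite -sum1_count natr_sum mulr_sumr.
rewrite big_seq_cond [leRHS]big_seq_cond; apply: ler_sum => p /andP[pl /eqP pk].
have E : fsize p.1 = (N - (fsize k).+1)%N.
  have := fsize_cut pl; rewrite pk; move: lN (fsize_lt_level lF).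
  by move: (fsize l) (fsize k) (fsize p.1) N; clear; lia.
(* [|k| <= N - 2] makes the left factor nonempty, as the bound on [X] demands. *)
rewrite mulr1 -E X_bound// E; move: kN.
by move: (fsize k) N; clear; lia.
Qed.

(** * Summation of the bounds over all components *)

Let tau := T `^ alpha.
Let bound_one := (c + 1) * K * tau + x * B.
Let bound_graft k := `|Zc k 0| + (tau * r k +
   \sum_(l <- F) b l * (x * (count (fun p => p.2 == k) (cuts R l))%:R)).
(** A sum over [k] in place of an inverse of grafting, so that it can be exchanged with the sum over
    [g]. *)
Let bound g := (if g == mone then bound_one else 0) +
  \sum_(k <- F) (if g == graft a k then bound_graft k else 0).

Lemma bound_one_ge0 : 0 <= bound_one.
Proof.
have c0 : 0 < c := sewing_const_gt0 theta_gt1.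
rewrite addr_ge0// mulr_ge0 ?powR_ge0//.
- by rewrite mulr_ge0 ?K_ge0// addr_ge0// ltW.
- by apply: sumr_ge0 => l _; exact: b_ge0.
Qed.

Lemma bound_graft_ge0 k : 0 <= bound_graft k.
Proof.
rewrite addr_ge0// addr_ge0// ?mulr_ge0 ?powR_ge0//.
by apply: sumr_ge0 => l _; rewrite mulr_ge0 ?b_ge0// mulr_ge0.
Qed.

(** The initial value is 0 at the empty forest, where the integral starts, and [Z^k_0] at [[k]_a];
    on forests of neither form everything vanishes. *)
Lemma rough_integration_component_bound g : g \in F ->
  (`|mcoeff g (J 0)|%:E +
   holder T (alpha *+ (N - fsize g)) (remainder X J g) <= (bound g)%:E)%E.
Proof.
move=> gF; have T0 : 0 <= (0 : R) <= T by rewrite lexx ltW.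
have sum_ge0 h : 0 <= \sum_(k <- F) (if h == graft a k then bound_graft k else 0).
  by apply: sumr_ge0 => k _; case: ifP => // _; exact: bound_graft_ge0.
have [->|g1] := eqVneq g mone.
  rewrite mcoeff_rough_integration_one rough_integral0 normr0 add0e.
  apply: (@le_trans _ _ bound_one%:E); last by rewrite lee_fin /bound eqxx lerDl.
  by rewrite fsize1 subn0; apply: holder_le => s t; exact: remainder_one_bound.
have [[k gk]|ga] := pselect (exists k, g = graft a k).
  have kN : low k.
    move: gF; rewrite gk mem_forests fsize_graft.
    by move: (fsize k) N; clear; lia.
  have kF : k \in F.
    by move: kN; rewrite mem_forests; move: (fsize k) N; clear; lia.
  rewrite gk mcoeff_rough_integration_graft kN.
  apply: (@le_trans _ _ (bound_graft k)%:E); last first.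
    rewrite lee_fin /bound [graft a k == mone]eq_sym one_neq_graft add0r.
    rewrite (big_fsetD1 k)//= eqxx lerDl; apply: sumr_ge0 => l _.
    by case: ifP => // _; exact: bound_graft_ge0.
  rewrite EFinD leeD2l//; apply: holder_le => s t sT tT st.
  exact: remainder_graft_bound.
have {}ga k : g <> graft a k by move=> E; apply: ga; exists k.
rewrite mcoeff_rough_integration_other//; last exact/eqP.
rewrite normr0 add0e; apply: (@le_trans _ _ 0%:E).
  apply: holder_le => s t sT tT _; rewrite remainder_other//; last exact/eqP.
  by rewrite normr0 mul0r.
by rewrite lee_fin addr_ge0//; case: ifP => // _; exact: bound_one_ge0.
Qed.

Lemma sum_pred1_le (E : {fset forest A}) h (v : R) : 0 <= v ->
  \sum_(g <- E) (if g == h then v else 0) <= v.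
Proof.
move=> v0; have [hE|hE] := boolP (h \in E).
  rewrite (big_fsetD1 h)//= eqxx [X in _ + X]big_seq big1 ?addr0// => g.
  by rewrite !inE => /andP[/negPf ->].
rewrite big_seq big1// => g gE; case: eqP => // gh.
by move: hE; rewrite -gh gE.
Qed.

(** Summed over [k], the counts for a fixed [l] are at most the number of all cuts of [l], hence at
    most [2^N] whatever the labels. *)
Lemma sum_bound_graft : \sum_(k <- F) bound_graft k <=
  \sum_(k <- F) `|Zc k 0| + tau * (\sum_(k <- F) r k) + x * (2 ^ N)%:R * B.
Proof.
rewrite !big_split /= -mulr_sumr addrA lerD// exchange_big /= mulr_sumr.
rewrite big_seq [leRHS]big_seq; apply: ler_sum => l lF.
rewrite -mulr_sumr mulrC ler_wpM2r ?b_ge0// -mulr_sumr ler_wpM2l//.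
rewrite -natr_sum ler_nat.
apply: (@leq_trans (size (cuts R l))).
  elim: (cuts R l) => [|p s IH] /=; first by rewrite big1.
  rewrite big_split /= -add1n leq_add//.
  have [pF|pF] := boolP (p.2 \in F).
    rewrite (big_fsetD1 p.2)//= eqxx big_seq big1 ?addn0// => g.
    by rewrite !inE eq_sym => /andP[/negPf ->].
  rewrite big_seq big1// => g gF; case: eqP => // pg.
  by move: pF; rewrite pg gF.
apply: leq_trans (size_cuts R l) _; rewrite leq_exp2l//.
exact/ltnW/fsize_lt_level.
Qed.

Lemma rough_integration_norm_bound :
  (controlled_norm alpha T X J <=
   ((c + 2 + (2 ^ N)%:R) * (1 + T `^ alpha) * (1 + x) *
    \sum_(h <- F) (`|Zc h 0| + r h))%:E)%E.
Proof.
rewrite /controlled_norm fsbig_finite; last exact: finite_forests.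
apply: (@le_trans _ _ (\sum_(g <- F) (bound g)%:E)%E).
  rewrite big_seq [leRHS]big_seq; apply: lee_sum => g.
  exact: rough_integration_component_bound.
rewrite sumEFin lee_fin.
(* For each [k] at most one [g] equals [[k]_a]. *)
have H1 : \sum_(g <- F) bound g <= bound_one + \sum_(k <- F) bound_graft k.
  rewrite big_split lerD ?sum_pred1_le ?bound_one_ge0//.
  rewrite exchange_big; apply: ler_sum => k _.
  by rewrite sum_pred1_le ?bound_graft_ge0.
apply: (le_trans H1); apply: (le_trans (lerD (lexx _) sum_bound_graft)).
rewrite /bound_one /K /B /b !big_split /= -mulr_sumr -/tau.
have c0 : 0 < c := sewing_const_gt0 theta_gt1.
have S0 : 0 <= \sum_(k <- F) `|Zc k 0| by apply: sumr_ge0.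
have Sr : 0 <= \sum_(k <- F) r k by apply: sumr_ge0.
have t0 : 0 <= tau by rewrite powR_ge0.
have M0 : 0 <= (2 ^ N)%:R :> R by rewrite ler0n.
by rewrite norm_polynomial_bound// ltW.
Qed.

Lemma rough_integration_supp t : [set` msupp (J t)] `<=` @forests A N.-1.
Proof.
move=> g /=; rewrite -mcoeff_neq0 => gJ; rewrite /forests /=.
have [->|g1] := eqVneq g mone; first by rewrite fsize1.
have [[k gk]|ga] := pselect (exists k, g = graft a k).
  move: gJ; rewrite gk mcoeff_rough_integration_graft fsize_graft.
  case: ifP => [|_]; last by rewrite eqxx.
  by move=> kN _; move: kN; move: (fsize k) N; clear; lia.
move: gJ; rewrite mcoeff_rough_integration_other ?eqxx//; first exact/eqP.
by move=> k E; apply: ga; exists k.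
Qed.

End RoughIntegral.

(** The supremum is at most a finite sum of finite seminorms. The one-node tree labelled [a] makes
    it a supremum over a nonempty set, hence nonnegative. *)
Lemma rough_norm_fin (R : realType) (A : finType) (alpha T : R)
    (X : R -> R -> hopf R A -> R) (a : A) :
  0 < T -> 0 < alpha -> alpha < 1 -> branched_rough_path alpha T X ->
  rough_norm alpha T X \is a fin_num /\ (0 <= rough_norm alpha T X)%E.
Proof.
move=> T0 a0 a1 [_ _ X_fin].
have ge0 : (0 <= rough_norm alpha T X)%E.
  apply: le_ereal_sup_tmp; exists (holder T (alpha *+ fsize (graft a mone))
    (fun s t => X s t (basis R (graft a mone)))); last exact: holder_ge0.
  exists (graft a mone) => //; split; last exact: graft_neq_one.
  by rewrite fsize_graft fsize1 level_gt0.
split=> //; rewrite ge0_fin_numE//.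
pose H h := holder T (alpha *+ fsize h) (fun s t => X s t (basis R h)).
have Hge0 h : (0 <= H h)%E by exact: holder_ge0.
apply: (@le_lt_trans _ _ (\sum_(h <- fset_set (@forests A (level alpha))) H h)%E).
  apply: ge_ereal_sup => _ [h [hN h1] <-].
  have hF : h \in fset_set (@forests A (level alpha)).
    by rewrite in_fset_set; [exact/asboolP|exact: finite_forests].
  rewrite (big_fsetD1 h)//=; apply: leeDl; exact: sume_ge0.
by apply: lte_sum_pinfty => h _; exact: X_fin.
Qed.

Theorem proposition2p19 (R : realType) (alpha : R)
    (alpha_gt0 : 0 < alpha) (alpha_lt1 : alpha < 1)
    (alpha_neq : forall n : nat, alpha <> n.+1%:R^-1) :
  exists C : R,
    forall (A : finType) (T : R) (X : R -> R -> hopf R A -> R) (a : A),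
      0 < T -> branched_rough_path alpha T X ->
      forall Z : R -> hopf R A, controlled alpha T X Z ->
        controlled alpha T X (rough_integration alpha X Z a) /\
        (controlled_norm alpha T X (rough_integration alpha X Z a) <=
         (C * (1 + T `^ alpha))%:E * (1 + rough_norm alpha T X)
         * controlled_norm alpha T X Z)%E.
Proof.
(* The constant depends on [alpha] alone: [2^N] counts cuts, and the sewing exponent is
   [(N + 1) alpha]. *)
exists (sewing_const (alpha *+ (level alpha).+1) + 2 + (2 ^ level alpha)%:R).
move=> A T X a T0 Xr Z [Z_supp Z_fin].
have [x_fin x0] := rough_norm_fin a T0 alpha_gt0 alpha_lt1 Xr.
pose F := fset_set (@forests A (level alpha).-1).
pose H h := holder T (alpha *+ (level alpha - fsize h)) (remainder X Z h).
have Hge0 h : (0 <= H h)%E by exact: holder_ge0.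
have normE : controlled_norm alpha T X Z =
    (\sum_(h <- F) (`|mcoeff h (Z 0)|%:E + H h))%E.
  by rewrite /controlled_norm fsbig_finite//; exact: finite_forests.
have H_fin h : h \in F -> (H h < +oo)%E.
  move=> hF; apply: le_lt_trans Z_fin; rewrite normE (big_fsetD1 h)//=.
  rewrite -addeA; apply: (@le_trans _ _ (H h + \sum_(g <- (F `\ h)%fset)
      (`|mcoeff g (Z 0)|%:E + H g))%E); last by rewrite leeDr.
  by apply: leeDl; apply: sume_ge0 => g _; apply: adde_ge0.
(* All seminorms of [Z] are finite, so its norm is a sum of real numbers and the real estimate
   applies. *)
have normE' : controlled_norm alpha T X Z =
    (\sum_(h <- F) (`|mcoeff h (Z 0)| + fine (H h)))%:E.
  rewrite normE -sumEFin big_seq [RHS]big_seq; apply: eq_bigr => h hF.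
  by rewrite EFinD fineK// ge0_fin_numE// H_fin.
have X_bound h : (0 < fsize h <= level alpha)%N ->
    forall s t : R, 0 <= s <= T -> 0 <= t <= T -> s != t ->
    `|X s t (basis R h)| <=
    fine (rough_norm alpha T X) * `|t - s| `^ (alpha *+ fsize h).
  move=> /andP[h0 hN] s t sT tT st; have [_ _ hX] := Xr.
  apply: le_trans (holder_bound T0 (hX h) sT tT st) _.
  rewrite ler_wpM2r ?powR_ge0// fine_le//.
    by rewrite ge0_fin_numE ?hX// holder_ge0.
  apply: ereal_sup_ubound; exists h => //; split=> //.
  by move=> h1; move: h0; rewrite h1 fsize1.
have R_bound h : h \in F ->
    forall s t : R, 0 <= s <= T -> 0 <= t <= T -> s != t ->
    `|remainder X Z h s t| <=
    fine (H h) * `|t - s| `^ (alpha *+ (level alpha - fsize h)).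
  by move=> hF; apply: holder_bound => //; exact: H_fin.
have main := rough_integration_norm_bound a T0 alpha_gt0 alpha_lt1 Xr Z_supp
  (fine_ge0 x0) (fun h => fine_ge0 (Hge0 h)) X_bound R_bound.
split; first split.
- by move=> t _; exact: rough_integration_supp.
- exact: le_lt_trans main (ltry _).
- apply: (le_trans main); rewrite normE' -[X in (1 + X)%E](fineK x_fin).
  by rewrite -EFinD -!EFinM.
Qed.
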